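(* Let $X,Y$ be real Banach spaces such that $X$ and $Y^*$ are reflexive, smooth and 2-convex, let $T:X\to Y$ be linear and continuous, let $f\in\Gamma(X)$, $g\in\Gamma(Y)$ be nonnegative, and assume that the saddle-point problem $$\min_{x\in X}\max_{p\in Y^*}\; -\langle Tx,p\rangle_Y+f(x)-g^*(-p)\qquad (S)$$ has a solution. Let $C_X,C_{Y^*}>0$ be constants with $\mathcal{B}_X(x,u)\ge \frac{C_X}{2}\|x-u\|_X^2$ for all $x,u\in X$ and $\mathcal{B}_{Y^*}(y^*,p)\ge\frac{C_{Y^*}}{2}\|y^*-p\|_{Y^*}^2$ for all $y^*,p\in Y^*$. Let $\sigma,\tau>0$ satisfy $\sqrt{\sigma\tau}\,\|T\|<\min\{C_X,C_{Y^*}\}$, let $(x_0,p_0)\in X\times Y^*$, $\hat x_0:=x_0$, and let $(x_k,p_k)_{k\in\mathbb{N}}$ be generated by $$p_{k+1}=(\sigma\,\partial g^*+J_{Y^*})^{-1}\big(J_{Y^*}(p_k)+\sigma T\hat x_k\big),\quad x_{k+1}=(\tau\,\partial f+J_X)^{-1}\big(J_X(x_k)-\tau T^*p_{k+1}\big),\quad \hat x_{k+1}=x_{k+1}+(x_{k+1}-x_k).$$ For $(x,y^* )\in X\times Y^*$ put $\triangle_k(x,y^* ):=\frac{\mathcal{B}_{Y^*}(y^*,p_k)}{\sigma}+\frac{\mathcal{B}_X(x,x_k)}{\tau}$. Then: (1) The sequence $(x_k,p_k)_{k\in\mathbb{N}}$ is bounded. More precisely, for every solution $(\bar x,-\bar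 p)$ of $(S)$ there is a constant $C\le\Big(1-\frac{\|T\|^2\sigma\tau}{C_XC_{Y^*}}\Big)^{-1}$ such that for all $N\in\mathbb{N}$ $$\triangle_N(\bar x,\bar p)\le C\,\triangle_0(\bar x,\bar p).$$ (2) For $N\ge 1$ let $x^N:=\frac1N\sum_{k=1}^N x_k\in X$ and $p^N:=\frac1N\sum_{k=1}^N p_k\in Y^*$. For every bounded set $B_1\times B_2\subset X\times Y^*$ the restricted primal-dual gap satisfies $$\mathcal{G}_{B_1\times B_2}(x^N,p^N)\le \frac1N\sup_{(x,y^* )\in B_1\times B_2}\triangle_0(x,y^* ).$$ Moreover, for every weak cluster point $(\tilde x,\tilde p)$ of the sequence $(x^N,p^N)_{N}$, the pair $(\tilde x,-\tilde p)$ solves $(S)$. (3) If in addition $X$ and $Y$ are finite dimensional, then there exists a solution $(\bar x,-\bar p)$ of $(S)$ such that $(x_k,p_k)$ converges strongly to $(\bar x,\bar p)$.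
   Context: For a Banach space $Z$ with dual $Z^*$ write $\langle z,z^*\rangle_Z=z^*(z)$. $\Gamma(Z)$ is the set of proper, convex, lower semicontinuous functions $Z\to(-\infty,+\infty]$; $h^*$ denotes the Fenchel conjugate and $\partial h(z)=\{z^*\in Z^*: \langle u-z,z^*\rangle_Z\le h(u)-h(z)\ \forall u\in Z\}$ the subdifferential. $Z$ is 2-convex if there is $C>0$ such that $\delta_Z(\epsilon):=\inf\{1-\|\tfrac12(x+u)\|_Z:\|x\|_Z=\|u\|_Z=1,\ \|x-u\|_Z\ge\epsilon\}\ge C\epsilon^2$ for all $\epsilon\in[0,2]$. $J_Z=\partial\big(\tfrac12\|\cdot\|_Z^2\big)$ is the normalized duality mapping; $J_X:X\to X^*$ and $J_{Y^*}:Y^*\to Y^{**}=Y$ are single-valued bijections in the present setting, with inverses $J_{X^*}$ and $J_Y$. For $h\in\Gamma(Z)$, $Z$ reflexive, and $\tau>0$, the generalized resolvent $(\tau\,\partial h+J_Z)^{-1}:Z^*\to Z$ is well-defined and single-valued: it maps $u$ to the unique $z$ with $u\in\tau\,\partial h(z)+J_Z(z)$ (for $h=g^*$ on $Y^*$ it maps $Y\to Y^*$). The Bregman distance is $\mathcal{B}_Z(u,x):=\tfrac12\|u\|_Z^2-\tfrac12\|x\|_Z^2-\langle u-x,J_Z(x)\rangle_Z$. Since $X$ and $Y^*$ are reflexive, smooth and 2-convex, constants $C_X,C_{Y^*}$ as in the claim exist. A pair $(\bar x,-\bar p)\in X\times Y^*$ solves $(S)$ iff $-T^*\bar p\in\partial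 f(\bar x)$ and $T\bar x\in\partial g^*(\bar p)$. The restricted (partial) primal-dual gap on $B_1\times B_2\subset X\times Y^*$ is $$\mathcal{G}_{B_1\times B_2}(x,p):=\sup_{p'\in B_2}\big(\langle Tx,p'\rangle_Y-g^*(p')+f(x)\big)-\inf_{x'\in B_1}\big(\langle Tx',p\rangle_Y-g^*(p)+f(x')\big).$$ *)

(* Defs.v *)
From HB Require Import structures.
From mathcomp Require Import all_boot all_order all_algebra.
From mathcomp Require Import all_classical all_reals all_analysis.
From mathcomp Require Import ring lra.

Set Implicit Arguments.
Unset Strict Implicit.
Unset Printing Implicit Defensive.

Import Order.TTheory GRing.Theory Num.Theory.
Import numFieldNormedType.Exports.

Local Open Scope classical_set_scope.
Local Open Scope ring_scope.

Section OperatorNorm.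
Context {R : realType} {V W : normedModType R}.

Definition opnorm (f : V -> W) : R :=
  sup [set `|f x| | x in [set x | `|x| <= 1]].

Lemma opnorm_has_ubound (f : {linear V -> W}) :
  continuous f -> has_ubound [set `|f x| | x in [set x | `|x| <= 1]].
Proof.
move=> cf; have /bounded_funP/(_ 1)[M fM] : bounded_near f (nbhs (0 : V)).
  by apply: continuous_linear_bounded; exact: cf.
by exists M => _ [x /= x1 <-]; exact: fM.
Qed.

Lemma opnorm_ub (f : {linear V -> W}) (x : V) :
  continuous f -> `|x| <= 1 -> `|f x| <= opnorm f.
Proof. by move=> cf x1; apply: ub_le_sup; [exact: opnorm_has_ubound|exists x]. Qed.

Lemma opnorm_le (f : V -> W) (M : R) :
  (forall x, `|x| <= 1 -> `|f x| <= M) -> opnorm f <= M.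
Proof.
move=> fM; apply: ge_sup; first by exists `|f 0|, 0; rewrite //= normr0.
by move=> _ [x /= x1 <-]; exact: fM.
Qed.

Lemma ler_opnorm (f : {linear V -> W}) (x : V) :
  continuous f -> `|f x| <= opnorm f * `|x|.
Proof.
move=> cf; have [->|x0] := eqVneq x 0; first by rewrite linear0 !normr0 mulr0.
have nx : 0 < `|x| by rewrite normr_gt0.
have : `|f (`|x|^-1 *: x)| <= opnorm f.
  by apply: opnorm_ub => //; rewrite normrZ ger0_norm ?invr_ge0// mulVf// gt_eqF.
by rewrite linearZ /= normrZ ger0_norm ?invr_ge0// mulrC ler_pdivrMr.
Qed.

End OperatorNorm.

Section DualType.
Context {R : realType} (Z : normedModType R).

Definition dual_pred : {pred (Z -> R)} :=
  [pred f : Z -> R | `[< linear f /\ continuous f >]].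

Record dual := Dual { dual_fun :> Z -> R ; _ : dual_fun \in dual_pred }.

HB.instance Definition _ := [isSub for dual_fun].
HB.instance Definition _ := [Choice of dual by <:].

Lemma dual_submod_closed : submod_closed dual_pred.
Proof.
split.
  apply/asboolP; split; last by move=> x; exact: cvg_cst.
  by move=> a x y /=; rewrite scaler0 addr0.
move=> a f g /asboolP[lf cf] /asboolP[lg cg]; apply/asboolP; split.
  move=> b x y.
  rewrite -[LHS]/(a * f (b *: x + y) + g (b *: x + y)).
  rewrite -[RHS]/(b * (a * f x + g x) + (a * f y + g y)) lf lg.
  by rewrite -![_ *: (_ : R)]/(_ * _); ring.
move=> x; apply: cvgD; last exact: cg.
by apply: cvgZr; exact: cf.
Qed.

HB.instance Definition _ :=
  GRing.isSubmodClosed.Build R (Z -> R) dual_pred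
    (GRing.submod_closed_semi dual_submod_closed).
HB.instance Definition _ := [SubChoice_isSubLmodule of dual by <:].

Lemma dual_linear (phi : dual) : linear (phi : Z -> R).
Proof. by case: phi => f /= /asboolP[]. Qed.

Lemma dual_continuous (phi : dual) : continuous (phi : Z -> R).
Proof. by case: phi => f /= /asboolP[]. Qed.

HB.instance Definition _ (phi : dual) :=
  GRing.isLinear.Build R Z R *:%R (dual_fun phi) (dual_linear phi).

Lemma dualDE (phi psi : dual) z : (phi + psi) z = phi z + psi z.
Proof. by []. Qed.

Lemma dualNE (phi : dual) z : (- phi) z = - phi z.
Proof. by []. Qed.

Lemma dualZE a (phi : dual) z : (a *: phi) z = a * phi z.
Proof. by []. Qed.

Lemma dual_ext (phi psi : dual) : (forall z, phi z = psi z) -> phi = psi.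
Proof. by move=> e; apply: val_inj; apply/funext. Qed.

Definition dual_norm (phi : dual) : R := opnorm (phi : Z -> R).

Lemma dual_normD (phi psi : dual) :
  dual_norm (phi + psi) <= dual_norm phi + dual_norm psi.
Proof.
apply: opnorm_le => x x1; rewrite dualDE (le_trans (ler_normD _ _))//.
by apply: lerD; apply: opnorm_ub => //; exact: dual_continuous.
Qed.

Lemma dual_norm_le_scale a (phi : dual) :
  dual_norm (a *: phi) <= `|a| * dual_norm phi.
Proof.
apply: opnorm_le => x x1; rewrite dualZE normrM ler_wpM2l//.
by apply: opnorm_ub => //; exact: dual_continuous.
Qed.

Lemma dual_norm_eq0 (phi : dual) : dual_norm phi = 0 -> phi = 0.
Proof.
move=> phi0; apply: dual_ext => z; apply/eqP; rewrite -normr_le0.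
have := ler_opnorm z (@dual_continuous phi).
by rewrite -/(dual_norm phi) phi0 mul0r.
Qed.

Lemma dual_normZ a (phi : dual) : dual_norm (a *: phi) = `|a| * dual_norm phi.
Proof.
apply/le_anti; rewrite dual_norm_le_scale /=.
have [->|a0] := eqVneq a 0.
  rewrite normr0 mul0r /dual_norm scale0r.
  by apply: (le_trans (normr_ge0 ((0 : dual) 0)));
    apply: opnorm_ub; [exact: dual_continuous|rewrite normr0].
rewrite -ler_pdivlMl ?normr_gt0// -normfV.
by have := dual_norm_le_scale a^-1 (a *: phi); rewrite scalerA mulVf// scale1r.
Qed.

HB.instance Definition _ :=
  Lmodule_isNormed.Build R dual dual_normD dual_normZ dual_norm_eq0.

End DualType.

Definition mk_dual {R : realType} {Z : normedModType R} (f : {linear Z -> R})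
    (cf : continuous f) : dual Z :=
  @Dual R Z f (introT (asboolP _) (conj (fun a => linearP f a) cf)).
Arguments dual_fun {R Z} _ _ : simpl never.

Section Bidual.
Context {R : realType} {Z : normedModType R}.

Lemma ler_dual (phi : dual Z) z : `|phi z| <= `|phi| * `|z|.
Proof. exact: ler_opnorm (@dual_continuous _ _ phi). Qed.

Definition eval_at (z : Z) (phi : dual Z) : R := phi z.

Lemma eval_at_linear z : linear (eval_at z).
Proof. by []. Qed.

HB.instance Definition _ z :=
  GRing.isLinear.Build R (dual Z) R *:%R (eval_at z) (eval_at_linear z).

Lemma eval_at_continuous z : continuous (eval_at z).
Proof.
apply: bounded_linear_continuous; apply/linear_boundedP.
near=> r => phi; rewrite (le_trans (ler_dual phi z))// mulrC ler_wpM2r//.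
Unshelve. all: by end_near. Qed.

Definition to_bidual (z : Z) : dual (dual Z) := mk_dual (@eval_at_continuous z).

Lemma to_bidualE z phi : to_bidual z phi = phi z.
Proof. by []. Qed.

End Bidual.

Section Adjoint.
Context {R : realType} {X Y : normedModType R}.
Variables (T : {linear X -> Y}) (cT : continuous T).

Lemma adjoint_continuous (q : dual Y) : continuous (q \o T).
Proof. by move=> x; apply: continuous_comp; [exact: cT|exact: dual_continuous]. Qed.

Definition adjoint (q : dual Y) : dual X := mk_dual (@adjoint_continuous q).

Lemma adjointE q x : adjoint q x = q (T x).
Proof. by []. Qed.

End Adjoint.

Section BanachGeometry.
Context {R : realType}.
Implicit Type Z : normedModType R.

Definition reflexive_space Z := forall F : dual (dual Z), exists z, F = to_bidual z.

Definition smooth_space Z := forall z : Z, z != 0 ->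
  exists! phi : dual Z, `|phi| = 1 /\ phi z = `|z|.

(* Valued in \bar R: the pairs (w.1, w.2) may form the empty set, whose infimum
   must then be +oo. *)
Definition convexity_modulus Z (eps : R) : \bar R :=
  ereal_inf [set (1 - `|2^-1 *: (w.1 + w.2)|)%:E | w in
    [set w : Z * Z | [/\ `|w.1| = 1, `|w.2| = 1 & eps <= `|w.1 - w.2|]]].

Definition two_convex Z := exists2 C : R, 0 < C &
  forall eps, 0 <= eps <= 2 -> ((C * eps ^+ 2)%:E <= convexity_modulus Z eps)%E.

Definition finite_dimensional (V : lmodType R) := exists (n : nat) (e : 'I_n -> V),
  forall v, exists c : 'I_n -> R, v = \sum_(i < n) c i *: e i.

(* The coarsest topology on Z that makes every element of dual Z continuous *)
Definition weak_topology Z := initial_topology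
  (fun z : Z => (fun phi : dual Z => phi z) : {ptws dual Z -> R}).

Definition weak_cluster_point Z (u : nat -> Z) (z : Z) :=
  cluster (u @ \oo : set_system (weak_topology Z)) z.

End BanachGeometry.

Section ConvexAnalysis.
Context {R : realType} {Z : normedModType R}.
Implicit Types (h : Z -> \bar R) (phi : dual Z).
Local Open Scope ereal_scope.

Definition proper_fun h := (forall z, h z != -oo) /\ exists z, h z != +oo.

Definition convex_efun h := forall (t : R) z u, (0 <= t <= 1)%R ->
  h (t *: z + (1 - t) *: u)%R <= t%:E * h z + (1 - t)%:E * h u.

Definition Gamma h := [/\ proper_fun h, convex_efun h & lower_semicontinuous h].

Definition fenchel_conj h phi : \bar R :=
  ereal_sup [set (phi z)%:E - h z | z in [set: Z]].

(* Since +oo - +oo = -oo, the subdifferential is empty wherever h is infinite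
   (subdiffP). *)
Definition subdiff h z : set (dual Z) :=
  [set phi | forall u, (phi (u - z)%R)%:E <= h u - h z].

Lemma subdiffP h z phi : subdiff h z phi <->
  h z \is a fin_num /\ forall u, h z + (phi (u - z)%R)%:E <= h u.
Proof.
split=> [sub|[hz sub] u]; last by rewrite leeBrDr// addeC.
have hz : h z \is a fin_num.
  by have := sub z; rewrite subrr linear0; case: (h z).
by split=> // u; rewrite addeC -leeBrDr.
Qed.

Definition duality_set (z : Z) : set (dual Z) :=
  subdiff (fun u => ((`|u| ^+ 2) / 2)%:E) z.

(* The single element of duality_set z when Z is smooth; 0 is a dummy value,
   used only if duality_set z is empty. *)
Definition duality_map (z : Z) : dual Z := xget 0%R (duality_set z).

(* The unique z with u \in tau * subdiff h z + J z when that inverse is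
   single-valued; 0 is a dummy value, used only if there is no such z. *)
Definition resolvent (tau : R) h (u : dual Z) : Z :=
  xget 0%R [set z | exists2 v, subdiff h z v & u = tau *: v + duality_map z]%R.

End ConvexAnalysis.

Definition bregman {R : realType} {Z : normedModType R} (u x : Z) : R :=
  `|u| ^+ 2 / 2 - `|x| ^+ 2 / 2 - duality_map x (u - x).

Section SaddlePoint.
Context {R : realType} {X Y : normedModType R}.
Variables (T : {linear X -> Y}) (cT : continuous T).
Variables (f : X -> \bar R) (g : Y -> \bar R).
Local Open Scope ereal_scope.

Definition saddle_fun (x : X) (q : dual Y) : \bar R :=
  (- q (T x))%:E + f x - fenchel_conj g (- q)%R.

(* Solutions of min_x max_q saddle_fun x q, by their optimality conditions;
   saddle_solutionP: these are exactly the saddle points of finite value. The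
   second subdifferential lives in the bidual of Y, hence to_bidual. *)
Definition saddle_solution (x : X) (q : dual Y) :=
  subdiff f x (adjoint cT q) /\
  subdiff (fenchel_conj g) (- q)%R (to_bidual (T x)).

Lemma saddle_solutionP (x : X) (q : dual Y) : saddle_solution x q <->
  [/\ f x \is a fin_num, fenchel_conj g (- q)%R \is a fin_num,
      forall q', saddle_fun x q' <= saddle_fun x q &
      forall x', saddle_fun x q <= saddle_fun x' q].
Proof.
rewrite /saddle_solution !subdiffP /saddle_fun; split.
  move=> [[fx sf] [gx sg]]; split=> // [q'|x'].
    have := sg (- q')%R; rewrite to_bidualE dualDE opprK dualNE.
    case: (f x) fx => // a _; case: (fenchel_conj g (- q)%R) gx => // b _.
    case: (fenchel_conj g (- q')%R) => [c| |]//=; rewrite ?leNye//.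
    by rewrite -?EFinN -!EFinD !lee_fin; lra.
  have := sf x'; rewrite adjointE !linearB /=.
  case: (f x) fx => // a _; case: (fenchel_conj g (- q)%R) gx => // b _.
  case: (f x') => [c| |]//=; rewrite ?leey//.
  by rewrite -?EFinN -!EFinD !lee_fin; lra.
move=> [fx gx sg sf]; split; split=> //.
  move=> x'; have := sf x'; rewrite adjointE !linearB /=.
  case: (f x) fx => // a _; case: (fenchel_conj g (- q)%R) gx => // b _.
  case: (f x') => [c| |]//=; rewrite ?leey//.
  by rewrite -?EFinN -!EFinD !lee_fin; lra.
move=> p; have := sg (- p)%R; rewrite to_bidualE dualDE !opprK.
case: (f x) fx => // a _; case: (fenchel_conj g (- q)%R) gx => // b _.
case: (fenchel_conj g p) => [c| |]//=; rewrite ?leey//.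
by rewrite -?EFinN -!EFinD !lee_fin; lra.
Qed.

(* Meaningful when f x and fenchel_conj g p are finite; +oo - +oo = -oo
   otherwise. *)
Definition restricted_gap (B1 : set X) (B2 : set (dual Y)) (x : X) (p : dual Y)
    : \bar R :=
  ereal_sup [set (p' (T x))%:E - fenchel_conj g p' + f x | p' in B2] -
  ereal_inf [set (p (T x'))%:E - fenchel_conj g p + f x' | x' in B1].

End SaddlePoint.

Definition bregman_sum {R : realType} {X Y : normedModType R} (sigma tau : R)
    (x : nat -> X) (p : nat -> dual Y) (k : nat) (u : X) (y : dual Y) : R :=
  bregman y (p k) / sigma + bregman u (x k) / tau.

(* average u 0 = 0, since 0^-1 = 0 *)
Definition average {R : realType} {V : lmodType R} (u : nat -> V) (N : nat) : V :=
  N%:R^-1 *: \sum_(1 <= k < N.+1) u k.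

(* Main.v *)
From HB Require Import structures.
Require Import Defs.
From mathcomp Require Import all_boot all_order all_algebra.
From mathcomp Require Import all_classical all_reals all_analysis.
From mathcomp Require Import ring lra.

Set Implicit Arguments.
Unset Strict Implicit.
Unset Printing Implicit Defensive.

Import Order.TTheory GRing.Theory Num.Theory.
Import numFieldNormedType.Exports.

Local Open Scope classical_set_scope.
Local Open Scope ring_scope.

(** The iteration is a proximal point method measured by Bregman distances, and one
    Lyapunov function carries all three claims. With d_k = xhat_k - x_k and a
    reference point (u, y), put

      W_k(u, y) = Delta_k(u, y) - <T d_k, y - p_k> + C_X |d_k|^2 / (2 tau).

    Each resolvent step is a subgradient inclusion. Adding the two subgradient
    inequalities at (u, y) and rewriting the duality-map terms by the three-point
    identity of Bregman distances yields [lyapunov_step]: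

      W_(k+1) + gap_(k+1)(u, y) + a |p_(k+1) - p_k|^2 + b |d_k|^2 <= W_k,

    where gap is the difference of Lagrangians L(x_(k+1), y) - L(u, p_(k+1)) and
    a, b > 0 because sqrt(sigma tau) |T| is below both C_X and C_Y. Young's
    inequality gives W_k >= (1 - q) Delta_k with q = |T|^2 sigma tau / (C_X C_Y) < 1
    ([lyapunov_ge]), and W_0 = Delta_0 since d_0 = 0.

    - At a solution the gap is nonnegative, so W decreases. This is the stability
      estimate, and it bounds the iterates.
    - For arbitrary (u, y), telescoping and Jensen's inequality bound the gap at the
      averages by Delta_0(u, y) / N ([ergodic_gap]). Both f and g* are suprema of
      continuous affine functions ([affine_minorant_gt], [fenchel_conj_gt]), and an
      affine function is weakly continuous, so the gap at a weak cluster point is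
      at most 0 for every (u, y), which is optimality.
    - At a solution W converges, hence the increments p_(k+1) - p_k and d_k tend
      to 0. In finite dimension the bounded iterates converge along an ultrafilter;
      the limit is a solution because subdifferentials have closed graphs
      ([subdiff_closed]) and J is demicontinuous. At this particular limit W tends
      to 0 along the ultrafilter, and since it is monotone it tends to 0 along the
      whole sequence, which forces strong convergence.

    What remains is that the resolvents are genuine solutions of their inclusions
    ([resolvent_subdiff]). The lower bound on the Bregman distance makes
    tau h + |.|^2 / 2 - xi strongly convex, so its minimizing sequences are Cauchy
    and a minimizer exists. The minimizer satisfies the inclusion because, in a
    smooth space, |.|^2 / 2 is Gateaux differentiable with derivative J
    ([energy_gateaux]): by the Hahn-Banach theorem a one-sided directional
    derivative that is not linear would have two different linear minorants. *)

(** * The Hahn-Banach theorem for sublinear functionals *)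

Section HahnBanach.
Context {R : realType}.

Lemma le_inf_image {I : Type} (A : set I) (F : I -> R) (c : R) :
  A !=set0 -> (forall i, A i -> c <= F i) -> c <= inf (F @` A).
Proof.
by move=> [i Ai] cF; apply: lb_le_inf; [exists (F i), i|move=> _ [j Aj <-]; exact: cF].
Qed.

Lemma inf_image_le {I : Type} (A : set I) (F : I -> R) (c : R) (i : I) :
  (forall i, A i -> c <= F i) -> A i -> inf (F @` A) <= F i.
Proof.
by move=> cF Ai; apply: ge_inf; [exists c => _ [j Aj <-]; exact: cF|exists i].
Qed.

Lemma le_inf_imageD {I J : Type} (A : set I) (B : set J) (F : I -> R) (G : J -> R)
    (c : R) : A !=set0 -> B !=set0 ->
  (forall i j, A i -> B j -> c <= F i + G j) ->
  c <= inf (F @` A) + inf (G @` B).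
Proof.
move=> A0 B0 cFG; rewrite -lerBlDr; apply: le_inf_image => // i Ai.
rewrite lerBlDr addrC -lerBlDr; apply: le_inf_image => // j Bj.
by rewrite lerBlDr addrC; exact: cFG.
Qed.

Context {V : lmodType R}.
Implicit Types (p q : V -> R).

Definition sublinear q :=
  (forall x y, q (x + y) <= q x + q y) /\
  (forall (t : R) x, 0 < t -> q (t *: x) <= t * q x).

Lemma sublinearZ q (t : R) x : sublinear q -> 0 <= t -> q (t *: x) = t * q x.
Proof.
move=> [qD qZ]; have q0 : q 0 = 0.
  have := qZ 2 0; have := qZ 2^-1 0; rewrite !scaler0 => /(_ _)/wrap[|h1]; first by lra.
  by move=> /(_ _)/wrap[|h2]; lra.
rewrite le_eqVlt => /predU1P[<-|t0]; first by rewrite scale0r mul0r.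
apply/le_anti; rewrite qZ//= -ler_pdivlMl//.
by rewrite (le_trans _ (qZ _ _ _)) ?invr_gt0// scalerA mulVf ?gt_eqF// scale1r.
Qed.

Lemma sublinear0 q : sublinear q -> q 0 = 0.
Proof. by move=> sq; have := sublinearZ 0 sq (lexx 0); rewrite scale0r mul0r. Qed.

Lemma sublinear_ge q x : sublinear q -> - q (- x) <= q x.
Proof.
by move=> sq; have := sq.1 x (- x); rewrite subrr (sublinear0 sq); lra.
Qed.

(** Subtracting the linear growth of [q] along the ray through [y] gives a smaller
    sublinear functional. If it equals [q], then q (x + y) = q x + q y for all x;
    hence a minimal sublinear functional is additive. *)
Definition flatten_at q (y x : V) : R :=
  inf ((fun t : R => q (x + t *: y) - t * q y) @` [set t | 0 <= t]).

Section Flatten.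
Variables (q : V -> R) (sq : sublinear q) (y : V).

Let below x (t : R) : 0 <= t -> - q (- x) <= q (x + t *: y) - t * q y.
Proof.
move=> t0; have := sq.1 (x + t *: y) (- x).
by rewrite addrAC subrr add0r (sublinearZ _ sq t0); lra.
Qed.

Let pos0 : [set t : R | 0 <= t] !=set0. Proof. by exists 0 => /=. Qed.

Lemma flatten_le x (t : R) : 0 <= t -> flatten_at q y x <= q (x + t *: y) - t * q y.
Proof. by move=> t0; apply: (inf_image_le (c := - q (- x))) => //; exact: below. Qed.

Lemma sublinear_flatten : sublinear (flatten_at q y).
Proof.
split=> [x x'|s x s0].
  apply: le_inf_imageD => // t t' t0 t'0; apply: le_trans (flatten_le _ (addr_ge0 t0 t'0)) _.
  by rewrite scalerDl addrACA; have := sq.1 (x + t *: y) (x' + t' *: y); lra.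
rewrite -ler_pdivrMl//; apply: le_inf_image => // t t0.
rewrite ler_pdivrMl//; apply: le_trans (flatten_le _ (mulr_ge0 (ltW s0) t0)) _.
by rewrite -scalerA -scalerDr (sublinearZ _ sq (ltW s0)); lra.
Qed.

Lemma flatten_le_id x : flatten_at q y x <= q x.
Proof. by have := flatten_le x (lexx 0); rewrite scale0r mul0r addr0 subr0. Qed.

Lemma flatten_opp : flatten_at q y (- y) <= - q y.
Proof. by have := flatten_le (- y) ler01; rewrite scale1r addNr (sublinear0 sq) mul1r sub0r. Qed.

End Flatten.

(** Zorn's lemma: the infimum of a chain of sublinear functionals below [p] is again
    sublinear, and it is finite because each of them is at least - p (- x). *)
Lemma minimal_sublinear p : sublinear p -> exists q, [/\ sublinear q,
  forall x, q x <= p x &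
  forall q', sublinear q' -> (forall x, q' x <= q x) -> q' = q].
Proof.
move=> sp; pose S := {q : V -> R | sublinear q /\ forall x, q x <= p x}.
pose rel_ge (s t : S) := `[< forall x, sval t x <= sval s x >].
have [|||A tA|m mmin] := @Zorn S rel_ge.
- by move=> s; apply/asboolP.
- move=> r s t /asboolP rs /asboolP st; apply/asboolP => x.
  exact: le_trans (st x) (rs x).
- move=> s t; case: s t => [q1 h1] [q2 h2] /asboolP /= le21 /asboolP /= le12.
  by apply: eq_exist; apply/funext => x; apply/le_anti; rewrite le12 le21.
- have [[s0 As0]|A0] := pselect (exists s, A s); last first.
    by exists (exist _ p (conj sp (fun x => lexx (p x)))) => s As; case: A0; exists s.
  have An0 : A !=set0 by exists s0.
  have below x (s : S) : A s -> - p (- x) <= sval s x.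
    move=> _; case: s => q [sq qp] /=; apply: le_trans (sublinear_ge _ sq).
    by rewrite lerN2.
  pose q x := inf ((fun s : S => sval s x) @` A).
  have qle x s : A s -> q x <= sval s x by move=> As; apply: inf_image_le (below x) As.
  have sq : sublinear q.
    split=> [x y|t x t0].
      apply: le_inf_imageD => // s t As At.
      (* along a chain the two members can be replaced by the smaller one *)
      have [/asboolP st|/asboolP ts] := tA _ _ As At.
        apply: le_trans (qle _ _ At) (le_trans ((proj2_sig t).1.1 _ _) _).
        by rewrite lerD2r.
      apply: le_trans (qle _ _ As) (le_trans ((proj2_sig s).1.1 _ _) _).
      by rewrite lerD2l.
    rewrite -ler_pdivrMl//; apply: le_inf_image => // s As.
    rewrite ler_pdivrMl//; apply: le_trans (qle _ _ As) _.
    exact: (proj2_sig s).1.2.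
  have qp x : q x <= p x by apply: le_trans (qle _ _ As0) ((proj2_sig s0).2 x).
  exists (exist _ q (conj sq qp)) => s As; apply/asboolP => x /=; exact: qle.
- exists (sval m); case: m mmin => q [sq qp] /= qmin; split=> // q' sq' q'q.
  have q'p x : q' x <= p x by exact: le_trans (q'q x) (qp x).
  have := qmin (exist _ q' (conj sq' q'p)) => /(_ _)/wrap[|e]; first exact/asboolP.
  by case: e.
Qed.

(** A minimal sublinear functional below [flatten_at p v] is linear, and flattening
    along [v] first is what forces equality at [v]. *)
Theorem Hahn_Banach_sublinear p (v : V) : sublinear p ->
  exists phi : {linear V -> R}, (forall x, phi x <= p x) /\ phi v = p v.
Proof.
move=> sp; have [q [sq qp qmin]] := minimal_sublinear (sublinear_flatten sp v).
have qadd x y : q (x + y) = q x + q y.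
  apply/le_anti; rewrite sq.1 /=.
  have e := qmin _ (sublinear_flatten sq y) (flatten_le_id sq y).
  have := flatten_le sq y x ler01; rewrite e scale1r mul1r; lra.
have qN x : q (- x) = - q x.
  by have := qadd x (- x); rewrite subrr (sublinear0 sq); lra.
have qlin : linear q.
  move=> a x y; rewrite qadd; congr (_ + _); rewrite -[RHS]/(a * q x).
  have [a0|/ltW a0] := leP 0 a; first exact: sublinearZ.
  rewrite -[a]opprK scaleNr qN (sublinearZ _ sq) ?oppr_ge0//; ring.
pose phi : {linear V -> R} := HB.pack q (GRing.isLinear.Build _ _ _ _ q qlin).
exists phi; split=> [x|]; first exact: le_trans (qp x) (flatten_le_id sp v x).
apply/le_anti; rewrite (le_trans (qp v) (flatten_le_id sp v v))/=.
have := le_trans (qp (- v)) (flatten_opp sp v); rewrite qN; lra.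
Qed.

End HahnBanach.

(** * The duality mapping as the Gateaux derivative of the energy *)

Section Duality.
Context {R : realType} {Z : normedModType R}.
Implicit Types (z u v w : Z) (phi psi : dual Z).

Definition energy z : R := `|z| ^+ 2 / 2.

Lemma energy_ge0 z : 0 <= energy z.
Proof. by rewrite divr_ge0// exprn_ge0. Qed.

Lemma energy_convex (a b : R) z u : 0 <= a -> 0 <= b -> a + b = 1 ->
  energy (a *: z + b *: u) <= a * energy z + b * energy u.
Proof.
move=> a0 b0 ab; have := ler_normD (a *: z) (b *: u).
rewrite !normrZ !ger0_norm// => n1.
have n2 : `|a *: z + b *: u| ^+ 2 <= (a * `|z| + b * `|u|) ^+ 2.
  by rewrite lerXn2r ?nnegrE ?normr_ge0 ?addr_ge0 ?mulr_ge0.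
have n3 : 0 <= a * b * (`|z| - `|u|) ^+ 2 by apply: mulr_ge0; [exact: mulr_ge0|exact: sqr_ge0].
have -> : b = 1 - a by lra.
rewrite (_ : b = 1 - a) in n2 n3; last by lra.
by rewrite /energy; nra.
Qed.

Definition energy_quotient z v (t : R) : R := (energy (z + t *: v) - energy z) / t.

(** The one-sided directional derivative of the energy, written as an infimum
    because difference energy_quotients of a convex function are monotone. *)
Definition energy_deriv z v : R := inf (energy_quotient z v @` [set t | 0 < t]).

Let pos0 : [set t : R | 0 < t] !=set0. Proof. by exists 1 => /=. Qed.

Lemma energy_quotient_ge z v t : 0 < t -> - (`|z| * `|v|) <= energy_quotient z v t.
Proof.
move=> t0; rewrite /energy_quotient ler_pdivlMr// /energy.
have n1 : `|z| <= `|z + t *: v| + t * `|v|.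
  have := ler_normB (z + t *: v) (t *: v).
  by rewrite addrK normrZ (gtr0_norm t0).
have [b0 a0] := (normr_ge0 z, normr_ge0 (z + t *: v)).
have c0 : 0 <= t * `|v| by rewrite mulr_ge0// ltW.
set a := `|z + _| in n1 a0 *; set b := `|z| in n1 b0 *.
rewrite (_ : - (b * `|v|) * t = - (b * (t * `|v|))); last by ring.
set c := t * `|v| in n1 c0 *.
have [bc|/ltW cb] := leP b c; first by have := ler_wpM2l b0 bc; nra.
have : (b - c) ^+ 2 <= a ^+ 2 by rewrite lerXn2r ?nnegrE ?subr_ge0// lerBlDr.
nra.
Qed.

Lemma energy_deriv_le z v t : 0 < t -> energy_deriv z v <= energy_quotient z v t.
Proof. by move=> t0; apply: inf_image_le (@energy_quotient_ge z v) t0. Qed.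

Lemma sublinear_energy_deriv z : sublinear (energy_deriv z).
Proof.
split=> [v w|c v c0].
  apply: le_inf_imageD => // s t /= s0 t0; have st0 := addr_gt0 s0 t0.
  pose r := s * t / (s + t).
  have r0 : 0 < r by rewrite divr_gt0 ?mulr_gt0.
  apply: le_trans (energy_deriv_le _ _ r0) _.
  (* z + r (v + w) is a convex combination of z + s v and z + t w *)
  have E : z + r *: (v + w) =
      (t / (s + t)) *: (z + s *: v) + (s / (s + t)) *: (z + t *: w).
    rewrite !scalerDr !scalerA addrACA -scalerDl.
    rewrite (_ : t / (s + t) + s / (s + t) = 1) ?scale1r; last by field; rewrite gt_eqF.
    by rewrite (_ : t / (s + t) * s = r) 1?(_ : s / (s + t) * t = r)//; rewrite /r; ring.
  have := @energy_convex (t / (s + t)) (s / (s + t)) (z + s *: v) (z + t *: w).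
  rewrite -E => /(_ _ _ _)/wrap[|||].
  - by rewrite divr_ge0 ?ltW.
  - by rewrite divr_ge0 ?ltW.
  - by field; rewrite gt_eqF.
  move=> h; rewrite /energy_quotient ler_pdivrMr//.
  set A := energy (z + s *: v) in h *; set B := energy (z + t *: w) in h *.
  rewrite (_ : _ * r = t / (s + t) * A + s / (s + t) * B - energy z); first by rewrite lerB.
  by rewrite /r; field; rewrite !gt_eqF.
rewrite -ler_pdivrMl//; apply: le_inf_image => // t /= t0.
have tc0 : 0 < t / c by rewrite divr_gt0.
rewrite ler_pdivrMl//; apply: le_trans (energy_deriv_le _ _ tc0) _.
rewrite /energy_quotient scalerA divfK ?gt_eqF// invf_div.
by rewrite le_eqVlt; apply/orP; left; apply/eqP; field; rewrite !gt_eqF.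
Qed.

Lemma energy_quotient_le z v (s t : R) : 0 < s -> s <= t -> energy_quotient z v s <= energy_quotient z v t.
Proof.
move=> s0 st; have t0 := lt_le_trans s0 st.
have := @energy_convex (1 - s / t) (s / t) z (z + t *: v) => /(_ _ _ _)/wrap[|||].
- by rewrite subr_ge0 ler_pdivrMr// mul1r.
- by rewrite divr_ge0 ?ltW.
- by ring.
rewrite (_ : _ *: z + _ = z + s *: v); last first.
  by rewrite scalerDr addrA -scalerDl subrK scale1r scalerA divfK ?gt_eqF.
set A := energy (z + t *: v); set B := energy z => h.
rewrite /energy_quotient ler_pdivrMr// -/A -/B.
rewrite (_ : _ * s = s / t * A - s / t * B); last by ring.
by rewrite mulrBl mul1r in h; lra.
Qed.

Lemma duality_setP z phi : duality_set z phi <->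
  forall u, phi (u - z) <= energy u - energy z.
Proof. by split=> h u; have := h u; rewrite /= -EFinB lee_fin. Qed.

Lemma duality_set_le z phi v : duality_set z phi -> phi v <= `|z| * `|v|.
Proof.
move=> /duality_setP h; apply/ler_addgt0Pr => e e0.
have d0 : 0 < `|v| ^+ 2 + 1 by rewrite ltr_wpDl ?exprn_ge0.
have [t t0 tE] : exists2 t, 0 < t & t * (`|v| ^+ 2 + 1) = e.
  by exists (e / (`|v| ^+ 2 + 1)); rewrite ?divr_gt0// divfK ?gt_eqF.
have := h (z + t *: v); rewrite addrAC subrr add0r linearZ /= /energy.
have := ler_normD z (t *: v); rewrite normrZ (gtr0_norm t0) => n1.
have n2 : `|z + t *: v| ^+ 2 <= (`|z| + t * `|v|) ^+ 2.
  by rewrite lerXn2r ?nnegrE// addr_ge0// mulr_ge0// ltW.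
rewrite -[_ *: phi v]/(t * phi v) => n3; rewrite -(ler_pM2l t0) -tE.
have : 0 <= t * t * `|v| ^+ 2 by apply: mulr_ge0; [apply: mulr_ge0; exact: ltW|exact: sqr_ge0].
have : 0 <= t * t by rewrite mulr_ge0 ?ltW.
nra.
Qed.

Lemma duality_set_norm_le z phi v : duality_set z phi -> `|phi v| <= `|z| * `|v|.
Proof.
move=> h; rewrite ler_norml duality_set_le// andbT lerNl.
by rewrite -linearN -(normrN v) duality_set_le.
Qed.

Lemma duality_set_diag z phi : duality_set z phi -> phi z = `|z| ^+ 2.
Proof.
move=> h; apply/le_anti; have h1 := duality_set_le z h.
rewrite expr2 h1/=; apply/ler_addgt0Pr => e e0.
have d0 : 0 < `|z| ^+ 2 + 1 by rewrite ltr_wpDl ?exprn_ge0.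
have [t t0 tE] : exists2 t, 0 < t & t * (`|z| ^+ 2 + 1) = e.
  by exists (e / (`|z| ^+ 2 + 1)); rewrite ?divr_gt0// divfK ?gt_eqF.
have /duality_setP/(_ ((1 - t) *: z)) := h.
rewrite scalerBl scale1r addrAC subrr add0r -scaleNr linearZ /= /energy.
rewrite -[X in `|X + _|]scale1r -scalerDl normrZ exprMn.
rewrite (_ : `|1 - t| ^+ 2 = (1 - t) ^+ 2); last by rewrite real_normK ?num_real.
move=> n3; rewrite -(ler_pM2l t0) -tE.
have : 0 <= t * t * `|z| ^+ 2 by apply: mulr_ge0; [apply: mulr_ge0; exact: ltW|exact: sqr_ge0].
have : 0 <= t * t by rewrite mulr_ge0 ?ltW.
rewrite -[_ *: phi z]/(- t * phi z) in n3.
nra.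
Qed.

Lemma duality_set_norm z phi : duality_set z phi -> `|phi| = `|z|.
Proof.
move=> h; apply/le_anti/andP; split.
  apply: opnorm_le => v v1; apply: le_trans (duality_set_norm_le v h) _.
  by rewrite ler_piMr.
have [->|z0] := eqVneq z 0; first by rewrite normr0.
have nz : 0 < `|z| by rewrite normr_gt0.
rewrite -(ler_pM2r nz); apply: le_trans (ler_dual phi z).
by rewrite (duality_set_diag h) ger0_norm ?exprn_ge0.
Qed.

(** Every directional derivative is attained by a subgradient: a linear functional
    below the directional derivative is a subgradient of the energy, and
    Hahn-Banach provides one that agrees with it at [v]. *)
Lemma duality_set_energy_deriv z v :
  exists2 phi, duality_set z phi & phi v = energy_deriv z v.
Proof.
have [phi [phile phiv]] := Hahn_Banach_sublinear v (sublinear_energy_deriv z).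
have phiE u : phi u <= energy (z + u) - energy z.
  apply: le_trans (phile u) _; have := energy_deriv_le z u ltr01.
  by rewrite /energy_quotient scale1r divr1.
have cphi : continuous phi.
  apply: bounded_linear_continuous; apply/bounded_funP => r.
  exists ((`|z| + r) ^+ 2 / 2) => u ur.
  have bnd (w : Z) : `|w| <= r -> phi w <= (`|z| + r) ^+ 2 / 2.
    move=> wr; apply: le_trans (phiE w) _.
    apply: (@le_trans _ _ (energy (z + w))); first by rewrite gerBl energy_ge0.
    rewrite ler_pM2r// lerXn2r ?nnegrE//.
      by rewrite addr_ge0// (le_trans _ wr).
    by rewrite (le_trans (ler_normD _ _))// lerD2l.
  by rewrite ler_norml bnd// andbT lerNl -linearN bnd// normrN.
exists (mk_dual cphi) => //; apply/duality_setP => u.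
by rewrite -[mk_dual cphi _]/(phi _); have := phiE (u - z); rewrite (addrC z) subrK.
Qed.

Lemma duality_mapP z : duality_set z (duality_map z).
Proof.
by have [phi h _] := duality_set_energy_deriv z 0; apply: xgetPex; exists phi.
Qed.

Lemma duality_map_sub z u : duality_map z (u - z) <= energy u - energy z.
Proof. by have /duality_setP := duality_mapP z; exact. Qed.

Lemma duality_map_norm z : `|duality_map z| = `|z|.
Proof. exact/duality_set_norm/duality_mapP. Qed.

Lemma duality_map_diag z : duality_map z z = `|z| ^+ 2.
Proof. exact/duality_set_diag/duality_mapP. Qed.

Hypothesis smoothZ : smooth_space Z.

(** A subgradient of the energy at z has norm |z| and value |z|^2 at z, so after
    division by |z| it is a norming functional, of which a smooth space has only
    one. *)
Lemma duality_set_unique z phi psi :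
  duality_set z phi -> duality_set z psi -> phi = psi.
Proof.
have [->|z0] := eqVneq z 0.
  have zero (xi : dual Z) : duality_set 0 xi -> xi = 0.
    by move=> /duality_set_norm; rewrite normr0 => /normr0_eq0.
  by move=> /zero -> /zero ->.
have nz : `|z| != 0 by rewrite normr_eq0.
have [chi [_ chiu]] := smoothZ z0.
have normed (xi : dual Z) : duality_set z xi -> xi = `|z| *: chi.
  move=> h; rewrite (chiu (`|z|^-1 *: xi)) ?scalerA ?divff ?scale1r//; split.
    by rewrite normrZ normfV normr_id (duality_set_norm h) mulVf.
  by rewrite dualZE (duality_set_diag h) expr2 mulKf.
by move=> /normed -> /normed ->.
Qed.

Lemma duality_map_deriv z v : duality_map z v = energy_deriv z v.
Proof.
have [phi h <-] := duality_set_energy_deriv z v.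
by rewrite (duality_set_unique (duality_mapP z) h).
Qed.

(** Gateaux differentiability in the one-sided form that suffices for convex
    arguments: the matching lower bound is the subgradient inequality. *)
Lemma energy_gateaux z v (e : R) : 0 < e -> exists2 d : R, 0 < d &
  forall t, 0 < t -> t <= d -> energy (z + t *: v) - energy z <= t * (duality_map z v + e).
Proof.
move=> e0; have : energy_deriv z v < duality_map z v + e.
  by rewrite duality_map_deriv ltrDl.
move=> /inf_lt[|_ [d d0 <-] dlt]; first by exists (energy_quotient z v 1), 1 => /=.
exists d => // t t0 td; rewrite mulrC -ler_pdivrMr//.
exact: le_trans (energy_quotient_le z v t0 td) (ltW dlt).
Qed.

End Duality.

(** * Demicontinuity of the duality mapping *)

Section Demicontinuity.
Context {R : realType} {Z : normedModType R} {I : Type} {F : set_system I}.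
Context {FF : Filter F}.

Lemma energy_cvg (u : I -> Z) (z : Z) :
  u i @[i --> F] --> z -> energy (u i) @[i --> F] --> energy z.
Proof.
move=> uz; rewrite /energy; under eq_fun do rewrite expr2.
rewrite expr2; have nu := cvg_norm uz.
apply: cvgM; last exact: cvg_cst.
by apply: cvgM; exact: nu.
Qed.

(** J (u i) v is at most the difference quotient of the energy at u i in the
    direction v for a fixed step d; letting u i tend to z gives the quotient at z,
    which is close to J z v for small d. The lower bound is the case of - v. *)
Lemma duality_map_demicontinuous (smoothZ : smooth_space Z) (u : I -> Z) (z v : Z) :
  u i @[i --> F] --> z -> duality_map (u i) v @[i --> F] --> duality_map z v.
Proof.
move=> uz.
have upper (w : Z) (e : R) : 0 < e ->
    \forall i \near F, duality_map (u i) w < duality_map z w + e.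
  move=> e0; have e20 : 0 < e / 2 by rewrite divr_gt0.
  have [d d0 /(_ d d0 (lexx d)) hd] := energy_gateaux smoothZ z w e20.
  have cv : energy (u i + d *: w) - energy (u i) @[i --> F] -->
      energy (z + d *: w) - energy z.
    apply: cvgB; last exact: energy_cvg.
    by apply: energy_cvg; apply: cvgD => //; exact: cvg_cst.
  have lt : energy (z + d *: w) - energy z < d * (duality_map z w + e).
    by apply: le_lt_trans hd _; rewrite ltr_pM2l// ltrD2l; lra.
  have : \forall i \near F, energy (u i + d *: w) - energy (u i) < d * (duality_map z w + e).
    exact: (cvgr_lt _ cv).
  apply: filterS => i hi; rewrite -(ltr_pM2l d0); apply: le_lt_trans hi.
  have := duality_map_sub (u i) (u i + d *: w).
  by rewrite addrAC subrr add0r linearZ.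
apply/cvgrPdist_lt => e e0.
have h1 := upper v e e0; have h2 := upper (- v) e e0.
near=> i; rewrite ltr_norml; apply/andP; split.
  have : duality_map (u i) v < duality_map z v + e by near: i.
  lra.
have : duality_map (u i) (- v) < duality_map z (- v) + e by near: i.
by rewrite !linearN /=; lra.
Unshelve. all: by end_near. Qed.

Lemma dual_cvg_apply {V : normedModType R} (phi : I -> dual V) (phi0 : dual V)
    (u : I -> V) (z : V) (M : R) :
  (\forall i \near F, `|phi i| <= M) ->
  (forall v, phi i v @[i --> F] --> phi0 v) ->
  u i @[i --> F] --> z -> phi i (u i) @[i --> F] --> phi0 z.
Proof.
move=> phiM phic uz.
have -> : (fun i => phi i (u i)) = (fun i => phi i z + phi i (u i - z)).
  by apply/funext => i; rewrite -linearD addrC subrK.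
rewrite -[phi0 z]addr0; apply: cvgD; first exact: phic.
apply/norm_cvg0P.
have nu : `|M| * `|u i - z| @[i --> F] --> `|M| * `|z - z|.
  apply: cvgM; first exact: cvg_cst.
  by apply: cvg_norm; apply: cvgB => //; exact: cvg_cst.
rewrite subrr normr0 mulr0 in nu.
apply: (squeeze_cvgr _ (cvg_cst (0 : R)) nu).
near=> i; rewrite normr_ge0/=; apply: le_trans (ler_dual _ _) _.
apply: ler_wpM2r => //; apply: le_trans (ler_norm M).
by near: i.
Unshelve. all: by end_near. Qed.

End Demicontinuity.

(** * Resolvents *)

Definition sequentially_complete {R : realType} (Z : normedModType R) :=
  forall u : nat -> Z,
    (forall e : R, 0 < e -> exists n0, forall m n, (n0 <= m)%N -> (n0 <= n)%N ->
      `|u m - u n| <= e) ->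
    exists z : Z, u @ \oo --> z.

Lemma lee_of_reals {R : realType} (a : \bar R) (b : R) :
  (forall c : R, (c%:E < a)%E -> c <= b) -> (a <= b%:E)%E.
Proof.
case: a => [r| |] h; last exact: leNye.
  rewrite lee_fin leNgt; apply/negP => br.
  by have := h ((b + r) / 2); rewrite lte_fin => /(_ _)/wrap[|]; lra.
by have := h (b + 1) (ltry _); rewrite gerDl ler10.
Qed.

Section Resolvent.
Context {R : realType} {Z : normedModType R}.
Hypothesis completeZ : sequentially_complete Z.
Variable C : R.
Hypothesis C_gt0 : 0 < C.
Hypothesis bregZ : forall x u : Z, C / 2 * `|x - u| ^+ 2 <= bregman x u.
Hypothesis smoothZ : smooth_space Z.

(** Strong convexity of the energy: add the Bregman bounds of both ends with respect
    to the midpoint, where the first-order terms cancel. *)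
Lemma energy_midpoint (a b : Z) :
  C / 8 * `|a - b| ^+ 2 <= (energy a + energy b) / 2 - energy (2^-1 *: a + 2^-1 *: b).
Proof.
set w := 2^-1 *: a + _.
have aw : a - w = 2^-1 *: (a - b).
  rewrite /w opprD addrA scalerBr; congr (_ - _).
  by rewrite -{1}[a]scale1r -scalerBl; congr (_ *: _); lra.
have bw : b - w = - (2^-1 *: (a - b)).
  rewrite /w opprD addrCA scalerBr opprB [LHS]addrC; congr (_ - _).
  by rewrite -{1}[b]scale1r -scalerBl; congr (_ *: _); lra.
have := bregZ a w; have := bregZ b w.
rewrite /bregman aw bw normrN normrZ linearN /= -/(energy a) -/(energy b) -/(energy w).
by rewrite ger0_norm ?invr_ge0// exprMn; lra.
Qed.

Variable h : Z -> \bar R.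
Hypothesis hG : Gamma h.
Variables (phi : dual Z) (c : R).
Hypothesis minorant : forall z, ((phi z + c)%:E <= h z)%E.

Let dom z := h z \is a fin_num.

Let domP z : dom z -> h z = (fine (h z))%:E. Proof. by move=> d; rewrite fineK. Qed.

Let dom_convex (t : R) z u : 0 <= t <= 1 -> dom z -> dom u ->
  dom (t *: z + (1 - t) *: u) /\
  fine (h (t *: z + (1 - t) *: u)) <= t * fine (h z) + (1 - t) * fine (h u).
Proof.
move=> t01 dz du; have [[hNy _] hconv _] := hG.
have := hconv t z u t01; rewrite (domP dz) (domP du) -!EFinM -EFinD /dom.
by case: (h _) (hNy (t *: z + (1 - t) *: u)) => //= r _; rewrite lee_fin.
Qed.

Variables (tau : R) (tau_gt0 : 0 < tau) (xi : dual Z).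

Let obj z : R := tau * fine (h z) + energy z - xi z.

(** The affine minorant of [h] bounds the objective below, strong convexity makes
    every minimizing sequence Cauchy, and lower semicontinuity makes its limit a
    minimizer. *)
Lemma prox_minimizer : exists2 z, h z \is a fin_num &
  forall w, h w \is a fin_num -> obj z <= obj w.
Proof.
have [[hNy [z0 z0y]] hconv hlsc] := hG.
have dz0 : dom z0 by rewrite /dom fin_numE hNy z0y.
pose psi := tau *: phi - xi.
have lb z : dom z -> tau * c - `|psi| ^+ 2 / 2 <= obj z.
  move=> dz; have := minorant z; rewrite (domP dz) lee_fin => hz.
  have hz' := ler_wpM2l (ltW tau_gt0) hz.
  have := ler_dual psi z; rewrite ler_norml => /andP[+ _].
  rewrite dualDE dualNE dualZE /obj /energy.
  have := sqr_ge0 (`|psi| - `|z|); nra.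
pose m := inf (obj @` [set z | dom z]).
have m_le z : dom z -> m <= obj z by move=> dz; apply: inf_image_le lb dz.
have min_seq n : {z | dom z & obj z <= m + n.+1%:R^-1}.
  apply: cid2; have : m < m + n.+1%:R^-1 by rewrite ltrDl invr_gt0.
  move=> /inf_lt[|_ [z dz <-] /ltW zm]; first by exists (obj z0), z0.
  by exists z.
pose u n := s2val (min_seq n).
have du n : dom (u n) := s2valP (min_seq n).
have um n : obj (u n) <= m + n.+1%:R^-1 := s2valP' (min_seq n).
have umid n k : C / 8 * `|u n - u k| ^+ 2 <= (n.+1%:R^-1 + k.+1%:R^-1) / 2.
  have h01 : 0 <= (2^-1 : R) <= 1 by apply/andP; split; lra.
  have := dom_convex h01 (du n) (du k).
  rewrite (_ : 1 - 2^-1 = 2^-1 :> R); last by lra.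
  move=> [dw hw]; have := m_le _ dw; have := ler_wpM2l (ltW tau_gt0) hw.
  have := energy_midpoint (u n) (u k); have := um n; have := um k.
  have xiw : xi (2^-1 *: u n + 2^-1 *: u k) = (xi (u n) + xi (u k)) / 2.
    by rewrite linearD !linearZ /= mulrDl; congr (_ + _); exact: mulrC.
  by rewrite /obj xiw; move: n.+1%:R^-1 k.+1%:R^-1 (energy _) => a b e; lra.
have [z uz] : exists z : Z, u @ \oo --> z.
  apply: completeZ => e e0.
  have Ce : 0 < C / 8 * e ^+ 2 by rewrite mulr_gt0 ?exprn_gt0 ?divr_gt0.
  have [n0 hn0] : exists n0 : nat, n0.+1%:R^-1 <= C / 8 * e ^+ 2.
    exists (Num.truncn (C / 8 * e ^+ 2)^-1); rewrite invf_ple ?posrE//.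
    exact/ltW/truncnS_gt.
  exists n0 => n k n0n n0k; rewrite -(@ler_pXn2r _ 2)// ?nnegrE ?(ltW e0)//.
  rewrite -(ler_pM2l (_ : 0 < C / 8)); last by rewrite divr_gt0.
  apply: le_trans (umid n k) (le_trans _ hn0).
  have : n.+1%:R^-1 <= n0.+1%:R^-1 :> R by rewrite lef_pV2 ?posrE// ler_nat.
  have : k.+1%:R^-1 <= n0.+1%:R^-1 :> R by rewrite lef_pV2 ?posrE// ler_nat.
  by move: n0.+1%:R^-1 n.+1%:R^-1 k.+1%:R^-1 => a b d; lra.
have hz : (h z <= ((m - energy z + xi z) / tau)%:E)%E.
  apply: lee_of_reals => a /hlsc[V nV aV].
  rewrite ler_pdivlMr// mulrC -subr_ge0.
  have -> : m - energy z + xi z - tau * a = m + 0 - (tau * a + energy z - xi z) by ring.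
  have cv : m + n.+1%:R^-1 - (tau * a + energy (u n) - xi (u n)) @[n --> \oo] -->
      m + 0 - (tau * a + energy z - xi z).
    apply: cvgB; first by apply: cvgD; [exact: cvg_cst|exact: cvg_harmonic].
    apply: cvgB.
      by apply: cvgD; [exact: cvg_cst|exact: energy_cvg].
    by apply: cvg_comp uz _; exact: dual_continuous.
  apply: (closed_cvg (fun x : R => 0 <= x)) cv; first exact: closed_ge.
  have nV' : \forall n \near \oo, V (u n) by exact: uz.
  near=> n; have /aV : V (u n) by near: n.
  rewrite (domP (du n)) lte_fin => /ltW aun.
  have := um n; have := ler_wpM2l (ltW tau_gt0) aun; rewrite /obj.
  by move: n.+1%:R^-1 => b; lra.
have dz : dom z.
  by rewrite /dom; case: (h z) (hNy z) hz.
exists z => // w dw; apply: le_trans (m_le w dw).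
move: hz; rewrite (domP dz) lee_fin ler_pdivlMr// mulrC /obj; lra.
Unshelve. all: by end_near. Qed.

(** Move from the minimizer z towards w by a small step t: convexity bounds the
    change of [h], Gateaux differentiability that of the energy. Dividing by t leaves
    the subgradient inequality up to an arbitrary e. *)
Lemma prox_optimality z : h z \is a fin_num ->
  (forall w, h w \is a fin_num -> obj z <= obj w) ->
  subdiff h z (tau^-1 *: (xi - duality_map z)).
Proof.
move=> dz zmin; apply/subdiffP; split=> // w; have [[hNy _] _ _] := hG.
have [dw|] := boolP (dom w); last first.
  by rewrite /dom fin_numE hNy /= negbK => /eqP ->; rewrite leey.
rewrite (domP dz) (domP dw) -EFinD lee_fin dualZE dualDE dualNE.
rewrite -lerBrDl ler_pdivrMl//; apply/ler_addgt0Pr => e e0.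
have [d d0 hd] := energy_gateaux smoothZ z (w - z) e0.
pose t := Num.min d 1.
have t0 : 0 < t by rewrite lt_min d0 ltr01.
have t1 : t <= 1 by rewrite ge_min lexx orbT.
have td : t <= d by rewrite ge_min lexx.
have /andP t01 : (0 <= t) && (t <= 1) by rewrite ltW.
have [dt ht] := dom_convex (introT andP t01) dw dz.
have tE : t *: w + (1 - t) *: z = z + t *: (w - z).
  by rewrite scalerBl scale1r scalerBr addrCA.
have := zmin _ dt; have := ler_wpM2l (ltW tau_gt0) ht; have := hd t t0 td.
have xit : xi (z + t *: (w - z)) = xi z + t * xi (w - z) by rewrite linearD linearZ.
rewrite /obj tE xit => h1 h2 h3; rewrite -(ler_pM2l t0).
by lra.
Qed.

(** The dummy value of [resolvent] never occurs, since the minimizer satisfies the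
    inclusion; the subgradient is read off from the inclusion. *)
Lemma resolvent_subdiff :
  subdiff h (resolvent tau h xi) (tau^-1 *: (xi - duality_map (resolvent tau h xi))).
Proof.
have [z dz zmin] := prox_minimizer.
have sz := prox_optimality dz zmin.
have tau0 : tau != 0 by rewrite gt_eqF.
set r := resolvent tau h xi.
have [v sv e] : [set z | exists2 v, subdiff h z v & xi = tau *: v + duality_map z] r.
  apply: xgetPex; exists z, (tau^-1 *: (xi - duality_map z)) => //.
  by rewrite scalerA divff// scale1r subrK.
by rewrite e addrK scalerA mulVf// scale1r.
Qed.

End Resolvent.

(** * Affine minorants *)

Section AffineMinorant.
Context {R : realType} {Z : normedModType R}.
Hypothesis completeZ : sequentially_complete Z.
Variable C : R.
Hypothesis C_gt0 : 0 < C.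
Hypothesis bregZ : forall x u : Z, C / 2 * `|x - u| ^+ 2 <= bregman x u.
Hypothesis smoothZ : smooth_space Z.

Lemma Gamma_translate (f : Z -> \bar R) (x0 : Z) : Gamma f ->
  Gamma (fun w => f (w + x0)).
Proof.
move=> [[fNy [z fz]] fconv flsc]; split.
- by split=> // ; exists (z - x0); rewrite subrK.
- move=> t u v t01; have := fconv t (u + x0) (v + x0) t01.
  by rewrite !scalerDr addrACA -scalerDl (addrC t) subrK scale1r.
- move=> u a /flsc[V nV aV]; exists ((fun w => w + x0) @^-1` V) => [|y /aV//].
  suff : {for u, continuous (fun w : Z => w + x0)} by move/(_ V nV).
  by apply: cvgD => //; exact: cvg_cst.
Qed.

(** The subgradient at the proximal point z of x0 with parameter tau gives an affine
    minorant of value f z + |z - x0|^2 / tau at x0. Near x0 the first term exceeds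
    [M] by lower semicontinuity; away from x0 the second does, once tau is small. *)
Lemma affine_minorant_gt (f : Z -> \bar R) (fG : Gamma f)
    (f_ge0 : forall z, (0 <= f z)%E) (x0 : Z) (M : R) : (M%:E < f x0)%E ->
  exists (phi : dual Z) (c : R),
    (forall w, ((phi w + c)%:E <= f w)%E) /\ M < phi x0 + c.
Proof.
move=> Mf; have [V /nbhs_ballP[r /= r0 rV] MV] := (let: And3 _ _ flsc := fG in flsc) _ _ Mf.
pose h w := f (w + x0).
have hG : Gamma h by exact: Gamma_translate.
have M0 : 0 < `|M| + 1 by rewrite ltr_wpDl.
(* with this step r^2 / tau = |M| + 1 exceeds M *)
pose tau := r ^+ 2 / (`|M| + 1).
have tau0 : 0 < tau by rewrite divr_gt0 ?exprn_gt0.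
have min0 z : (((0 : dual Z) z + 0)%:E <= h z)%E by rewrite addr0; exact: f_ge0.
have := resolvent_subdiff completeZ C_gt0 bregZ smoothZ hG min0 tau0 0.
set z := resolvent tau h 0; rewrite sub0r => /subdiffP[hz hsub].
pose c := fine (h z) + `|z| ^+ 2 / tau.
exists (- (tau^-1 *: duality_map z)), (c + tau^-1 * duality_map z x0); split.
  move=> w; have := hsub (w - x0); rewrite {2}/h subrK -{1}(fineK hz) -EFinD.
  apply: le_trans; rewrite lee_fin dualZE !dualNE dualZE !linearB /= duality_map_diag /c.
  by rewrite le_eqVlt; apply/orP; left; apply/eqP; ring.
rewrite dualNE dualZE addrC addrK /c.
have hz0 : 0 <= fine (h z) by apply: fine_ge0; exact: f_ge0.
have [zr|rz] := ltP `|z| r.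
  have /MV : V (z + x0).
    by apply: rV; rewrite -ball_normE /= opprD addrCA subrr addr0 normrN.
  rewrite -/(h z) -{1}(fineK hz) lte_fin => hM.
  by apply: ltr_wpDr => //; rewrite divr_ge0 ?exprn_ge0// ltW.
apply: ltr_wpDl => //; apply: le_lt_trans (ler_norm M) _.
rewrite ltr_pdivlMr// /tau mulrA ltr_pdivrMr//.
have : r ^+ 2 <= `|z| ^+ 2 by rewrite lerXn2r ?nnegrE// ltW.
by have := exprn_gt0 2 r0; have := normr_ge0 M; nra.
Qed.

End AffineMinorant.

(** * Completeness of the dual and conjugate functions *)
Lemma complete_sequentially {R : realType} (X : completeNormedModType R) :
  sequentially_complete X.
Proof.
move=> u uC; have : cvg (u @ \oo).
  apply/cauchy_cvgP/cauchy_exP => e e0.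
  have [n0 hn0] : exists n0, forall m n, (n0 <= m)%N -> (n0 <= n)%N -> `|u m - u n| <= e / 2.
    by apply: uC; rewrite divr_gt0.
  exists (u n0); suff : \forall n \near \oo, ball (u n0) e (u n) by [].
  near=> n; rewrite -ball_normE /=.
  apply: (@le_lt_trans _ _ (e / 2)); last by rewrite ltr_pdivrMr// ltr_pMr// ltr1n.
  by apply: hn0 => //; near: n; exact: nbhs_infty_ge.
by move=> /cvg_ex.
Unshelve. all: by end_near. Qed.

(** The pointwise limit is linear, and the Cauchy estimate passes to the limit
    uniformly on the unit ball, which gives both its continuity and the convergence
    in norm. *)
Lemma dual_sequentially_complete {R : realType} (Y : normedModType R) :
  sequentially_complete (dual Y).
Proof.
move=> u uC.
have ucvg y : exists l : R, u n y @[n --> \oo] --> l.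
  apply: (@complete_sequentially R R) => e e0.
  have y0 : 0 < `|y| + 1 by rewrite ltr_wpDl.
  have [n0 hn0] := uC (e / (`|y| + 1)) (divr_gt0 e0 y0).
  exists n0 => m n n0m n0n; rewrite -[u m y - u n y]/((u m - u n) y).
  apply: le_trans (ler_dual _ _) _.
  apply: (@le_trans _ _ (e / (`|y| + 1) * (`|y| + 1))); last by rewrite divfK ?gt_eqF.
  by apply: ler_pM => //; [exact: hn0|rewrite lerDl].
pose l y := sval (cid (ucvg y)).
have ul y : u n y @[n --> \oo] --> l y by rewrite /l; case: cid.
have llin : linear l.
  move=> a x y; apply: (cvg_unique _ (ul (a *: x + y))) => //.
  rewrite (_ : (fun n => _) = fun n => a * u n x + u n y); last first.
    by apply/funext => n; rewrite linearP.
  by apply: cvgD => //; apply: cvgM => //; exact: cvg_cst.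
have unif (e : R) : 0 < e -> exists n0, forall n, (n0 <= n)%N -> forall y,
    `|u n y - l y| <= e * `|y|.
  move=> /uC[n0 hn0]; exists n0 => n n0n y.
  have cv : `|u n y - u m y| @[m --> \oo] --> `|u n y - l y|.
    by apply: cvg_norm; apply: cvgB => //; exact: cvg_cst.
  apply: (closed_cvg (fun x : R => x <= e * `|y|)) cv; first exact: closed_le.
  near=> m; rewrite -[u n y - u m y]/((u n - u m) y).
  apply: le_trans (ler_dual _ _) _; apply: ler_wpM2r => //; apply: hn0 => //.
  by near: m; exact: nbhs_infty_ge.
pose L : {linear Y -> R} := HB.pack l (GRing.isLinear.Build _ _ _ _ l llin).
have cL : continuous L.
  have [n0 hn0] := unif 1 ltr01.
  apply: bounded_linear_continuous; apply/bounded_funP => r.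
  exists ((`|u n0| + 1) * `|r|) => y yr; rewrite -[L y]/(l y).
  apply: (@le_trans _ _ ((`|u n0| + 1) * `|y|)); last first.
    by rewrite ler_wpM2l ?addr_ge0// (le_trans yr) ?ler_norm.
  have := hn0 n0 (leqnn _) y; have := ler_dual (u n0) y.
  have := ler_normB (u n0 y) (u n0 y - l y); rewrite opprB addrCA subrr addr0.
  lra.
exists (mk_dual cL); apply/cvgrPdist_le => e e0.
have [n0 hn0] := unif e e0; near=> n.
apply: opnorm_le => y y1; rewrite dualDE dualNE -normrN opprB -[mk_dual cL y]/(l y).
apply: (@le_trans _ _ (e * `|y|)); last by rewrite ler_piMr// ltW.
by apply: hn0; near: n; exact: nbhs_infty_ge.
Unshelve. all: by end_near. Qed.

Section Conjugate.
Context {R : realType} {Y : normedModType R}.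
Variable g : Y -> \bar R.

Lemma fenchel_young (p : dual Y) (y : Y) : ((p y)%:E - g y <= fenchel_conj g p)%E.
Proof. by apply: ereal_sup_ubound; exists y. Qed.

Lemma fenchel_conj_minorant (y : Y) (p : dual Y) : g y \is a fin_num ->
  ((to_bidual y p - fine (g y))%:E <= fenchel_conj g p)%E.
Proof. by move=> gy; rewrite EFinB fineK//; exact: fenchel_young. Qed.

(** The conjugate is by definition a supremum of the affine functions
    p |-> p y - g y, so a strict lower bound is witnessed by one of them. *)
Lemma fenchel_conj_gt (p : dual Y) (a : R) : (forall y, g y != -oo%E) ->
  (a%:E < fenchel_conj g p)%E ->
  exists2 y, g y \is a fin_num & a < p y - fine (g y).
Proof.
move=> gNy /ereal_sup_gt[_ [y _ <-] ay]; exists y.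
  by rewrite fin_numE gNy; apply/eqP => gy; rewrite gy in ay.
by move: ay (gNy y); case: (g y) => //= r; rewrite -EFinB lte_fin.
Qed.

Lemma Gamma_fenchel_conj : proper_fun g -> (exists p, fenchel_conj g p != +oo%E) ->
  Gamma (fenchel_conj g).
Proof.
move=> [gNy [y0 gy0]] [p0 gp0].
have dy0 : g y0 \is a fin_num by rewrite fin_numE gNy gy0.
split.
- split; last by exists p0.
  by move=> p; have := fenchel_conj_minorant p dy0; case: fenchel_conj.
- move=> t p q /andP[t0 t1]; apply: ge_ereal_sup => _ [y _ <-].
  have := fenchel_young p y; have := fenchel_young q y.
  move: (gNy y); case: (g y) => [r| |] // _; last by move=> _ _; exact: leNye.
  rewrite -!EFinB => /(lee_wpmul2l (x := (1 - t)%:E)) h1 /(lee_wpmul2l (x := t%:E)) h2.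
  have t1' : 0 <= 1 - t by rewrite subr_ge0.
  have := leeD (h2 t0) (h1 t1'); apply: le_trans.
  rewrite -!EFinM -EFinD lee_fin dualDE !dualZE le_eqVlt; apply/orP; left.
  by apply/eqP; ring.
- move=> p a /(fenchel_conj_gt gNy)[y dy ay].
  have {}ay : a + fine (g y) < to_bidual y p by rewrite -ltrBrDr.
  exists [set q : dual Y | a + fine (g y) < q y].
    exact: (cvgr_gt _ (@dual_continuous _ _ (to_bidual y) p) _ ay).
  move=> q /= aq; apply: lt_le_trans (fenchel_conj_minorant q dy).
  by rewrite lte_fin ltrBrDr.
Qed.

End Conjugate.

(** * Closed graphs and the three-point identity *)

Section ClosedGraph.
Context {R : realType} {Z : normedModType R} {I : Type} {F : set_system I}.
Context {FF : ProperFilter F}.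

(** Pass to the limit in h (u i) + phi i (w - u i) <= h w, bounding the first term
    below by lower semicontinuity. The subgradients only have to converge when
    paired with w - u i, which is what demicontinuity of J provides. *)
Lemma subdiff_closed (h : Z -> \bar R) (u : I -> Z) (z : Z)
    (phi : I -> dual Z) (phi0 : dual Z) :
  proper_fun h -> lower_semicontinuous h ->
  (\forall i \near F, subdiff h (u i) (phi i)) ->
  u i @[i --> F] --> z ->
  (forall w, phi i (w - u i) @[i --> F] --> phi0 (w - z)) ->
  subdiff h z phi0.
Proof.
move=> [hNy [z0 hz0]] hlsc hsub uz hphi.
have key w : h w \is a fin_num -> (h z <= (fine (h w) - phi0 (w - z))%:E)%E.
  move=> hw; apply: lee_of_reals => a /hlsc[V nV aV].
  have cv : fine (h w) - phi i (w - u i) @[i --> F] --> fine (h w) - phi0 (w - z).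
    by apply: cvgB; [exact: cvg_cst|exact: hphi].
  apply: (closed_cvg (fun x : R => a <= x)) cv; first exact: closed_ge.
  have nV' : \forall i \near F, V (u i) by exact: uz.
  near=> i; have /aV : V (u i) by near: i.
  have /subdiffP[hu /(_ w)] : subdiff h (u i) (phi i) by near: i.
  rewrite -(fineK hu) -(fineK hw) -EFinD lee_fin lte_fin => h1 h2 /=.
  by rewrite lerBrDr; apply: le_trans h1; rewrite lerD2r ltW.
have hz : h z \is a fin_num.
  have dz0 : h z0 \is a fin_num by rewrite fin_numE hNy hz0.
  by have := key _ dz0; have := hNy z; case: (h z).
apply/subdiffP; split=> // w.
have [hw|] := boolP (h w \is a fin_num); last first.
  by rewrite fin_numE hNy /= negbK => /eqP ->; rewrite leey.
by have := key _ hw; rewrite -(fineK hz) -(fineK hw) -EFinD !lee_fin /=; lra.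
Unshelve. all: by end_near. Qed.

End ClosedGraph.

Section ThreePoint.
Context {R : realType} {Z : normedModType R}.

Lemma bregman_three_point (u a b : Z) :
  bregman u a - bregman u b - bregman b a = (duality_map b - duality_map a) (u - b).
Proof. by rewrite /bregman dualDE dualNE !linearB /=; ring. Qed.

(** The subgradient inequality of a Bregman proximal step from a to b, driven by the
    linear functional chi. *)
Lemma proximal_step (h : Z -> \bar R) (tau : R) (chi : dual Z) (a b u : Z) : 0 < tau ->
  subdiff h b (tau^-1 *: (duality_map a + tau *: chi - duality_map b)) ->
  h u \is a fin_num ->
  fine (h b) + chi (u - b) + (bregman u b + bregman b a - bregman u a) / tau
    <= fine (h u).
Proof.
move=> tau0 /subdiffP[hb /(_ u)] + hu.
rewrite -(fineK hb) -(fineK hu) -EFinD lee_fin /=; apply: le_trans.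
rewrite -addrA lerD2l.
have -> : bregman u b + bregman b a - bregman u a =
   - (duality_map b - duality_map a) (u - b) by rewrite -bregman_three_point; ring.
rewrite !(dualZE, dualDE, dualNE).
by rewrite le_eqVlt; apply/orP; left; apply/eqP; field; rewrite gt_eqF.
Qed.

End ThreePoint.

(** * Averages *)

Section Average.
Context {R : realType}.

Lemma averageS {V : lmodType R} (u : nat -> V) (N : nat) : (0 < N)%N ->
  average u N.+1 =
  (N%:R / N.+1%:R) *: average u N + (1 - N%:R / N.+1%:R) *: u N.+1.
Proof.
move=> N0; have N0' : N%:R != 0 :> R by rewrite pnatr_eq0 -lt0n.
have N1 : N.+1%:R != 0 :> R by rewrite pnatr_eq0.
rewrite /average big_nat_recr//= scalerDr scalerA mulrAC divff// mul1r.
congr (_ + _ *: _); rewrite -[X in X - _](divff N1) -mulrBl -natrB//.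
by rewrite subSnn mul1r.
Qed.

Lemma average_linear {V : lmodType R} (phi : {linear V -> R}) (u : nat -> V) (N : nat) :
  phi (average u N) = N%:R^-1 * \sum_(1 <= k < N.+1) phi (u k).
Proof. by rewrite /average linearZ linear_sum. Qed.

(** Jensen's inequality by induction on [N], since the average of N + 1 terms is a
    convex combination of the average of [N] terms and the last one. *)
Lemma average_jensen {Z : normedModType R} (h : Z -> \bar R) (u : nat -> Z) :
  (forall z, h z != -oo%E) -> convex_efun h ->
  (forall k, h (u k.+1) \is a fin_num) -> forall N, (0 < N)%N ->
  h (average u N) \is a fin_num /\
  N%:R * fine (h (average u N)) <= \sum_(1 <= k < N.+1) fine (h (u k)).
Proof.
move=> hNy hconv hu; elim=> // -[_ _|N /(_ isT) [IHf IH] _].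
  by rewrite /average big_nat1 invr1 scale1r mul1r big_nat1; split; first exact: hu.
rewrite averageS// big_nat_recr//=.
set t := N.+1%:R / N.+2%:R; set a := average u N.+1 in IHf IH *.
have N2 : 0 < N.+2%:R :> R by rewrite ltr0n.
have t01 : 0 <= t <= 1.
  by rewrite divr_ge0//= ler_pdivrMr// mul1r ler_nat.
have := hconv t a (u N.+2) t01; set w := _ + _.
rewrite -(fineK IHf) -(fineK (hu N.+1)) -!EFinM -EFinD.
have := hNy w; case: (h w) => //= r _; rewrite lee_fin => rle; split=> //.
have := ler_wpM2l (ltW N2) rle.
have -> : N.+2%:R * (t * fine (h a) + (1 - t) * fine (h (u N.+2))) =
   N.+1%:R * fine (h a) + fine (h (u N.+2)).
  have e : N.+2%:R = N.+1%:R + 1 :> R by rewrite natr1.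
  have : 0 < N.+1%:R :> R by rewrite ltr0n.
  rewrite /t e; move: (N.+1%:R : R) => n n0.
  by field; rewrite gt_eqF// addr_gt0.
by move=> /le_trans; apply; rewrite lerD2r.
Qed.

End Average.

(** The side conditions exclude the combinations of infinities for which a - b has
    the conventional value -oo and carries no information. *)
Lemma ereal_sup_inf_le {R : realType} (A B : set (\bar R)) (c : R) :
  (forall a b, A a -> B b -> (a - b <= c%:E)%E) ->
  (forall a, A a -> a != +oo%E) -> (forall b, B b -> b != -oo%E) ->
  (ereal_sup A - ereal_inf B <= c%:E)%E.
Proof.
move=> AB Ay By.
have key a : A a -> (a - c%:E <= ereal_inf B)%E.
  move=> Aa; apply: le_ereal_inf_tmp => b Bb.
  move: (AB _ _ Aa Bb) (Ay _ Aa) (By _ Bb); case: a {Aa} => [a| |]; case: b {Bb} => [b| |] //=;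
    try by move=> _ _ _; rewrite ?addNye ?leNye ?leey.
  by rewrite -!EFinB !lee_fin; lra.
case e : (ereal_inf B) => [i| |]; last 2 first.
- by rewrite addeNy leNye.
- suff -> : ereal_sup A = -oo%E by rewrite addNye leNye.
  apply/eqP; rewrite -leeNy_eq; apply: ge_ereal_sup => a Aa.
  by move: (key _ Aa) (Ay _ Aa); rewrite e; case: a {Aa}.
rewrite leeBlDr//; apply: ge_ereal_sup => a Aa.
move: (key _ Aa) (Ay _ Aa); rewrite e; case: a {Aa} => [a| |]//=.
  by rewrite -EFinB -EFinD !lee_fin; lra.
by move=> _ _; rewrite leNye.
Qed.

(** * Weak cluster points *)

Section Pairing.
Context {R : realType} {U V : normedModType R}.

Lemma pair_dual_linear (phi : dual U) (psi : dual V) :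
  linear (fun w : U * V => phi w.1 + psi w.2).
Proof.
move=> a w w' /=; rewrite !linearP /=.
by rewrite -![_ *: (_ : R)]/(_ * _); ring.
Qed.

Lemma pair_dual_continuous (phi : dual U) (psi : dual V) :
  continuous (fun w : U * V => phi w.1 + psi w.2).
Proof.
move=> w; apply: cvgD.
  by apply: continuous_comp; [exact: cvg_fst|exact: dual_continuous].
by apply: continuous_comp; [exact: cvg_snd|exact: dual_continuous].
Qed.

Definition pair_dual (phi : dual U) (psi : dual V) : dual (U * V)%type :=
  let lin : {linear (U * V)%type -> R} := HB.pack (fun w : U * V => phi w.1 + psi w.2)
    (GRing.isLinear.Build _ _ _ _ _ (pair_dual_linear phi psi)) in
  @mk_dual R (U * V)%type lin (@pair_dual_continuous phi psi).

Lemma pair_dualE phi psi w : pair_dual phi psi w = phi w.1 + psi w.2.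
Proof. by []. Qed.

End Pairing.

(** Half-spaces {phi > c + e / 2} are weakly open, so a cluster point cannot lie in
    one that the sequence eventually avoids. *)
Lemma weak_cluster_le {R : realType} {Z : normedModType R} (u : nat -> Z) (z : Z)
    (phi : dual Z) (c : R) : weak_cluster_point u z ->
  (forall e, 0 < e -> \forall N \near \oo, phi (u N) <= c + e) -> phi z <= c.
Proof.
move=> uz uc; apply/ler_addgt0Pr => e e0; rewrite leNgt; apply/negP => lt.
have e20 : 0 < e / 2 by rewrite divr_gt0.
pose A : set Z := [set w | phi w <= c + e / 2].
pose B : set (weak_topology Z) := [set w : Z | c + e / 2 < phi w].
have nB : nbhs (z : weak_topology Z) B.
  have cphi : continuous (fun w : weak_topology Z => (phi : Z -> R) w).
    move=> w.
    have ic := @initial_continuous Z {ptws dual Z -> R} (fun z0 : Z => (fun psi : dual Z => psi z0)) w.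
    apply: (@continuous_comp _ _ _ _ (fun k : {ptws dual Z -> R} => k phi) w ic).
    exact: (@proj_continuous _ (fun _ : dual Z => R) phi).
  apply: (cvgr_gt _ (cphi z)); lra.
have [w [wA wB]] := uz A B (uc _ e20) nB.
by move: wA wB; rewrite /A /B /=; lra.
Qed.

(** * Bounded sequences in finite dimension *)

Section DualFrame.
Context {R : realType}.

(** When this is the identity, norm convergence amounts to convergence of the scalar
    coordinates q.2 v, and bounded sequences have bounded coordinates. *)
Definition frame_expansion {V : normedModType R} (s : seq (V * dual V)) (v : V) : V :=
  \sum_(q <- s) q.2 v *: q.1.

Section Construction.
Context {V : normedModType R}.

Fixpoint in_span (l : seq V) (v : V) : Prop :=
  if l is a :: l' then exists t : R, in_span l' (v - t *: a) else v = 0.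

Lemma in_span_sum {I : Type} (r : seq I) (e : I -> V) (c : I -> R) :
  in_span (map e r) (\sum_(i <- r) c i *: e i).
Proof.
elim: r => [|i r IH] /=; first by rewrite big_nil.
by exists (c i); rewrite big_cons addrC addKr.
Qed.

Lemma in_span_map (P : {linear V -> V}) (l : seq V) (v : V) :
  in_span l v -> in_span (map P l) (P v).
Proof.
elim: l v => [|a l IH] v /=; first by move=> ->; rewrite linear0.
by move=> [t /IH]; rewrite linearB linearZ /=; exists t.
Qed.

(** Gram-Schmidt with duality maps in place of inner products: phi = J a / |a|^2
    takes the value 1 at a, so v |-> v - phi v a is a projection that kills a and
    reduces the number of spanning vectors. Its composition with the functionals of
    the reduced frame gives the functionals of the new one. *)
Lemma in_span_frame (l : seq V) :
  exists s, forall v, in_span l v -> v = frame_expansion s v.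
Proof.
have [n] := ubnP (size l); elim: n l => // n IH [|a l] /=.
  by exists [::] => v ->; rewrite /frame_expansion big_nil.
rewrite ltnS => ln; have [->|a0] := eqVneq a 0.
  by have [s hs] := IH l ln; exists s => v [t]; rewrite scaler0 subr0; exact: hs.
pose phi : dual V := `|a| ^- 2 *: duality_map a.
have phia : phi a = 1.
  by rewrite dualZE duality_map_diag mulVf// expf_neq0// normr_eq0.
pose proj (v : V) := v - phi v *: a.
have proj_lin : linear proj.
  move=> t v w; rewrite /proj linearP /= scalerDl scalerBr -scalerA opprD addrACA.
  by [].
pose P : {linear V -> V} := HB.pack proj (GRing.isLinear.Build _ _ _ _ proj proj_lin).
have [|s hs] := IH (map P l); first by rewrite size_map.
exists ((a, phi) :: map (fun q : V * dual V => (q.1, (q.2 - q.2 a *: phi)%R : dual V)) s) => v [t vt].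
have /hs : in_span (map P l) (P v).
  have -> : P v = P (v - t *: a); last exact: in_span_map.
  have Pa : P a = 0 by rewrite -[P a]/(a - phi a *: a) phia scale1r subrr.
  by rewrite (linearB P) (linearZ_LR P) Pa scaler0 subr0.
rewrite /frame_expansion big_cons big_map => Pv.
have vE : v = phi v *: a + P v by rewrite -[P v]/(v - phi v *: a) addrC subrK.
rewrite {1}vE Pv; congr (_ + _); apply: eq_bigr => q _ /=; congr (_ *: _).
by rewrite linearB linearZ_LR dualDE dualNE dualZE; congr (_ - _); exact: mulrC.
Qed.

Lemma finite_dimensional_frame : finite_dimensional V ->
  exists s, forall v : V, v = frame_expansion s v.
Proof.
move=> [n [e he]]; have [s hs] := in_span_frame (map e (index_enum 'I_n)).
by exists s => v; apply: hs; have [c ->] := he v; exact: in_span_sum.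
Qed.

End Construction.

Lemma dual_frame {V : normedModType R} (s : seq (V * dual V)) :
  (forall v, v = frame_expansion s v) ->
  forall phi, phi = frame_expansion (map (fun q : V * dual V => (q.2, to_bidual q.1)) s) phi.
Proof.
move=> hs phi; apply: dual_ext => v; rewrite [in LHS](hs v) /frame_expansion big_map /=.
rewrite linear_sum /=; elim: s {hs} => [|q s IH]; first by rewrite !big_nil.
rewrite !big_cons dualDE dualZE IH; congr (_ + _).
by rewrite linearZ /= mulrC.
Qed.

(** Ultrafilters replace the extraction of successive subsequences: a single one
    makes all coordinates converge. *)
Lemma bounded_ultra_cvg (U : set_system nat) (UU : UltraFilter U) (a : nat -> R) (M : R) :
  (forall k, `|a k| <= M) -> exists l : R, a k @[k --> U] --> l.
Proof.
move=> aM.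
have ultra : UltraFilter (a k @[k --> U]).
  split=> [|G GF sG]; first exact: fmap_proper_filter.
  apply/seteqP; split => // B GB.
  have [//|nB] := in_ultra_setVsetC (a @^-1` B) UU.
  have /sG GnB : (a k @[k --> U]) (~` B) by [].
  by have := filter_ex (filterI GB GnB) => -[t []].
have := @segment_compact R (- M) M; rewrite compact_ultra => seg.
have [l [_ al]] : [set` `[- M, M]] `&` [set l | a k @[k --> U] --> l] !=set0.
  apply: seg; suff : \forall k \near U, [set` `[- M, M]] (a k) by [].
  by apply: filterE => k /=; rewrite in_itv /= -ler_norml.
by exists l.
Qed.

Lemma frame_ultra_cvg {V : normedModType R} (s : seq (V * dual V))
    (U : set_system nat) (UU : UltraFilter U) (u : nat -> V) (M : R) :
  (forall v, v = frame_expansion s v) -> (forall k, `|u k| <= M) ->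
  exists l : V, u k @[k --> U] --> l.
Proof.
move=> hs uM.
suff [l hl] : exists l : V, frame_expansion s (u k) @[k --> U] --> l.
  by exists l; rewrite (_ : (fun k => u k) = fun k => frame_expansion s (u k)) //;
    apply/funext => k; exact: hs.
rewrite /frame_expansion; elim: s {hs} => [|q s [l hl]].
  by exists 0; under eq_fun do rewrite big_nil; exact: cvg_cst.
have [m hm] : exists m : R, q.2 (u k) @[k --> U] --> m.
  apply: (@bounded_ultra_cvg _ UU _ (`|q.2| * M)) => k.
  by apply: le_trans (ler_dual _ _) _; exact: ler_wpM2l.
exists (m *: q.1 + l); under eq_fun do rewrite big_cons.
by apply: cvgD => //; apply: cvgZr_tmp.
Qed.

End DualFrame.

(** * The Lyapunov function of the primal-dual iteration *)

Section Lyapunov.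
Context {R : realType} {X Y : normedModType R}.
Variables (T : {linear X -> Y}) (cT : continuous T).
Variables (f : X -> \bar R) (gs : dual Y -> \bar R).
Variables (CX CY : R) (CX_gt0 : 0 < CX) (CY_gt0 : 0 < CY).
Hypothesis bregX : forall x u : X, CX / 2 * `|x - u| ^+ 2 <= bregman x u.
Hypothesis bregY : forall y p : dual Y, CY / 2 * `|y - p| ^+ 2 <= bregman y p.
Variables (sigma tau : R) (sigma_gt0 : 0 < sigma) (tau_gt0 : 0 < tau).
Hypothesis step : Num.sqrt (sigma * tau) * opnorm T < Num.min CX CY.
Variables (x xhat : nat -> X) (p : nat -> dual Y).
Hypothesis xhat0 : xhat 0%N = x 0%N.
Hypothesis xhat_iter : forall k, xhat k.+1 = x k.+1 + (x k.+1 - x k).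
Hypothesis p_sub : forall k, subdiff gs (p k.+1)
  (sigma^-1 *: (duality_map (p k) + sigma *: to_bidual (T (xhat k)) - duality_map (p k.+1))).
Hypothesis x_sub : forall k, subdiff f (x k.+1)
  (tau^-1 *: (duality_map (x k) + tau *: (- adjoint cT (p k.+1)) - duality_map (x k.+1))).

Let L : R := opnorm T.
Let theta : R := Num.sqrt (sigma * tau) * L.

Lemma opnorm_ge0 : 0 <= L.
Proof. by apply: le_trans (opnorm_ub cT (_ : `|0| <= 1)); rewrite ?normr0. Qed.

Lemma theta_ge0 : 0 <= theta.
Proof. by rewrite mulr_ge0 ?sqrtr_ge0 ?opnorm_ge0. Qed.

Lemma theta_ltX : theta < CX.
Proof. by apply: lt_le_trans step _; rewrite ge_min lexx. Qed.

Lemma theta_ltY : theta < CY.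
Proof. by apply: lt_le_trans step _; rewrite ge_min lexx orbT. Qed.

Definition contraction_ratio : R := L ^+ 2 * sigma * tau / (CX * CY).

Lemma contraction_ratio_lt1 : contraction_ratio < 1.
Proof.
rewrite /contraction_ratio ltr_pdivrMr ?mulr_gt0// mul1r.
have -> : L ^+ 2 * sigma * tau = theta ^+ 2.
  by rewrite /theta exprMn sqr_sqrtr ?mulr_ge0 ?ltW//; ring.
have := theta_ge0; have := theta_ltX; have := theta_ltY; rewrite expr2 => *.
by rewrite ltr_pM.
Qed.

Lemma coupling_le (y : dual Y) (d : X) : `|y (T d)| <= L * (`|y| * `|d|).
Proof.
apply: le_trans (ler_dual _ _) _; rewrite mulrCA; apply: ler_wpM2l => //.
exact: ler_opnorm.
Qed.

(** Young's inequality with the weights sqrt (tau / sigma) and sqrt (sigma / tau),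
    which distribute theta evenly over the two squared increments. *)
Lemma coupling_le_theta (y : dual Y) (d : X) :
  `|y (T d)| <= theta / 2 * (`|y| ^+ 2 / sigma + `|d| ^+ 2 / tau).
Proof.
apply: le_trans (coupling_le y d) _; rewrite /theta sqrtrM ?(ltW sigma_gt0)//.
have s0 : 0 < Num.sqrt sigma by rewrite sqrtr_gt0.
have t0 : 0 < Num.sqrt tau by rewrite sqrtr_gt0.
rewrite -{2}(sqr_sqrtr (ltW sigma_gt0)) -{2}(sqr_sqrtr (ltW tau_gt0)).
move: (Num.sqrt sigma) (Num.sqrt tau) s0 t0 => s t s0 t0.
rewrite -subr_ge0.
have -> : s * t * L / 2 * (`|y| ^+ 2 / s ^+ 2 + `|d| ^+ 2 / t ^+ 2) - L * (`|y| * `|d|) =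
  L / (2 * s * t) * (t * `|y| - s * `|d|) ^+ 2.
  by field; rewrite !gt_eqF.
apply: mulr_ge0; last exact: sqr_ge0.
by apply: divr_ge0; [exact: opnorm_ge0|rewrite !mulr_ge0// ltW].
Qed.

Definition inertia k : X := xhat k - x k.

Lemma inertia0 : inertia 0 = 0.
Proof. by rewrite /inertia xhat0 subrr. Qed.

Lemma inertiaS k : inertia k.+1 = x k.+1 - x k.
Proof. by rewrite /inertia xhat_iter addrAC subrr add0r. Qed.

(** L (x k, y) - L (u, p k) for the Lagrangian L (x, p) = <T x, p> + f x - gs p. *)
Definition lagrangian_gap k (u : X) (y : dual Y) : R :=
  (fine (f (x k)) + y (T (x k)) - fine (gs y)) -
  (fine (f u) + p k (T u) - fine (gs (p k))).

(** The coupling term is the part of <T (xhat k - x k.+1), y - p k.+1> that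
    telescopes. The last term, a lower bound of the Bregman gain of the previous
    primal step, is kept in reserve to absorb that coupling. *)
Definition lyapunov k (u : X) (y : dual Y) : R :=
  bregman_sum sigma tau x p k u y - (y - p k) (T (inertia k)) +
  CX / 2 * `|inertia k| ^+ 2 / tau.

Lemma lyapunov0 u y : lyapunov 0 u y = bregman_sum sigma tau x p 0 u y.
Proof.
by rewrite /lyapunov inertia0 (linear0 T) (linear0 (y - p 0%N)) normr0 expr0n /= mulr0 mul0r subr0 addr0.
Qed.

(** The error <T d_k, p_(k+1) - p_k> left by telescoping is bounded by
    theta / 2 times the scaled squared increments. The dual Bregman gain and the
    reserve in W_k dominate it because theta is smaller than C_Y and C_X. *)
Lemma lyapunov_step k (u : X) (y : dual Y) : f u \is a fin_num -> gs y \is a fin_num ->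
  lyapunov k.+1 u y + lagrangian_gap k.+1 u y +
  (CY - theta) / 2 * (`|p k.+1 - p k| ^+ 2 / sigma) +
  (CX - theta) / 2 * (`|inertia k| ^+ 2 / tau) <= lyapunov k u y.
Proof.
move=> fu gy.
have := proximal_step sigma_gt0 (p_sub k) gy.
have := proximal_step tau_gt0 (x_sub k) fu.
have := coupling_le_theta (p k.+1 - p k) (inertia k); rewrite ler_norml => /andP[].
have : CX / 2 * `|inertia k.+1| ^+ 2 / tau <= bregman (x k.+1) (x k) / tau.
  by rewrite ler_pM2r ?invr_gt0// inertiaS.
have : CY / 2 * `|p k.+1 - p k| ^+ 2 / sigma <= bregman (p k.+1) (p k) / sigma.
  by rewrite ler_pM2r ?invr_gt0.
have pE (q q' : dual Y) v : (q - q') (T v) = q (T v) - q' (T v) by [].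
have Txhat q : (q : dual Y) (T (xhat k)) = q (T (x k)) + q (T (inertia k)).
  by rewrite -2!linearD /inertia addrC subrK.
have Tinertia q : (q : dual Y) (T (inertia k.+1)) = q (T (x k.+1)) - q (T (x k)).
  by rewrite inertiaS 2!linearB.
have adjE : (- adjoint cT (p k.+1)) (u - x k.+1) = p k.+1 (T (x k.+1)) - p k.+1 (T u).
  by rewrite dualNE adjointE 2!linearB opprB.
have evalE : to_bidual (T (xhat k)) (y - p k.+1) =
  y (T (xhat k)) - p k.+1 (T (xhat k)) by [].
rewrite /lyapunov /lagrangian_gap /bregman_sum adjE evalE !pE !Tinertia !Txhat.
lra.
Qed.

Lemma bregman_sum_geX k u y : CX / 2 * `|u - x k| ^+ 2 / tau <= bregman_sum sigma tau x p k u y.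
Proof.
rewrite /bregman_sum -[X in X <= _]add0r; apply: lerD.
  apply: divr_ge0; last exact: ltW.
  by apply: le_trans (bregY _ _); rewrite mulr_ge0 ?exprn_ge0 ?divr_ge0// ltW.
by rewrite ler_pM2r ?invr_gt0.
Qed.

Lemma bregman_sum_geY k u y : CY / 2 * `|y - p k| ^+ 2 / sigma <= bregman_sum sigma tau x p k u y.
Proof.
rewrite /bregman_sum -[X in X <= _]addr0; apply: lerD.
  by rewrite ler_pM2r ?invr_gt0.
apply: divr_ge0; last exact: ltW.
by apply: le_trans (bregX _ _); rewrite mulr_ge0 ?exprn_ge0 ?divr_ge0// ltW.
Qed.

Lemma bregman_sum_ge0 k u y : 0 <= bregman_sum sigma tau x p k u y.
Proof.
apply: le_trans (bregman_sum_geX k u y).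
by rewrite !divr_ge0 ?mulr_ge0 ?exprn_ge0 ?divr_ge0// ltW.
Qed.

(** Completing a square: |T| |y - p_k| |d_k| is at most the reserve
    C_X |d_k|^2 / (2 tau) plus the fraction [contraction_ratio] of the dual part of
    the Bregman sum. *)
Lemma lyapunov_ge k u y :
  (1 - contraction_ratio) * bregman_sum sigma tau x p k u y <= lyapunov k u y.
Proof.
have r0 : 0 <= contraction_ratio.
  by rewrite /contraction_ratio !mulr_ge0 ?invr_ge0 ?mulr_ge0 ?opnorm_ge0 ?(ltW sigma_gt0) ?(ltW tau_gt0) ?(ltW CX_gt0) ?(ltW CY_gt0).
have := coupling_le (y - p k) (inertia k); rewrite ler_norml => /andP[_ h1].
have h2 : contraction_ratio * (CY / 2 * `|y - p k| ^+ 2 / sigma) <=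
    contraction_ratio * bregman_sum sigma tau x p k u y.
  by apply: ler_wpM2l => //; exact: bregman_sum_geY.
have h3 : L * (`|y - p k| * `|inertia k|) <=
    contraction_ratio * (CY / 2 * `|y - p k| ^+ 2 / sigma) + CX / 2 * `|inertia k| ^+ 2 / tau.
  rewrite -subr_ge0 /contraction_ratio.
  have -> : L ^+ 2 * sigma * tau / (CX * CY) * (CY / 2 * `|y - p k| ^+ 2 / sigma) +
      CX / 2 * `|inertia k| ^+ 2 / tau - L * (`|y - p k| * `|inertia k|) =
      (L * tau * `|y - p k| - CX * `|inertia k|) ^+ 2 / (2 * CX * tau).
    by field; rewrite !gt_eqF.
  by rewrite divr_ge0 ?sqr_ge0// !mulr_ge0// ltW.
rewrite /lyapunov; lra.
Qed.

Lemma lyapunov_ge0 k u y : 0 <= lyapunov k u y.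
Proof.
apply: le_trans (lyapunov_ge k u y); apply: mulr_ge0; last exact: bregman_sum_ge0.
by rewrite subr_ge0 ltW// contraction_ratio_lt1.
Qed.

Let coefX_gt0 : 0 < (CX - theta) / 2 / tau.
Proof. by rewrite !divr_gt0// subr_gt0 theta_ltX. Qed.

Let coefY_gt0 : 0 < (CY - theta) / 2 / sigma.
Proof. by rewrite !divr_gt0// subr_gt0 theta_ltY. Qed.

Lemma sum_lagrangian_gap N u y : f u \is a fin_num -> gs y \is a fin_num ->
  \sum_(1 <= k < N.+1) lagrangian_gap k u y <= bregman_sum sigma tau x p 0 u y.
Proof.
move=> fu gy; rewrite -lyapunov0.
suff : lyapunov N u y + \sum_(1 <= k < N.+1) lagrangian_gap k u y <= lyapunov 0 u y.
  by apply: le_trans; rewrite lerDr lyapunov_ge0.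
elim: N => [|N IH]; first by rewrite big_geq// addr0.
rewrite big_nat_recr//= addrCA addrA; apply: le_trans IH; rewrite [X in _ <= X]addrC -addrA lerD2l.
have := lyapunov_step N fu gy.
have := mulr_ge0 (ltW coefX_gt0) (sqr_ge0 `|inertia N|).
have := mulr_ge0 (ltW coefY_gt0) (sqr_ge0 `|p N.+1 - p N|).
lra.
Qed.

Section Solution.
Variables (xb : X) (pb : dual Y).
Hypothesis xb_sub : subdiff f xb (adjoint cT (- pb)).
Hypothesis pb_sub : subdiff gs pb (to_bidual (T xb)).

(** The subgradient inequalities at the solution, evaluated at the iterates; the
    coupling terms cancel. *)
Lemma lagrangian_gap_ge0 k : 0 <= lagrangian_gap k.+1 xb pb.
Proof.
have /subdiffP[fx /(_ (x k.+1))] := xb_sub; have /subdiffP[gx /(_ (p k.+1))] := pb_sub.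
have /subdiffP[fk _] := x_sub k; have /subdiffP[gk _] := p_sub k.
rewrite -(fineK fx) -(fineK gx) -(fineK fk) -(fineK gk) -!EFinD !lee_fin.
rewrite /lagrangian_gap to_bidualE adjointE dualNE 2!linearB dualDE dualNE /=; lra.
Qed.

Lemma lyapunov_decrease k :
  lyapunov k.+1 xb pb + (CY - theta) / 2 / sigma * `|p k.+1 - p k| ^+ 2 +
  (CX - theta) / 2 / tau * `|inertia k| ^+ 2 <= lyapunov k xb pb.
Proof.
have /subdiffP[fx _] := xb_sub; have /subdiffP[gx _] := pb_sub.
have := lyapunov_step k fx gx; have := lagrangian_gap_ge0 k; lra.
Qed.

Lemma lyapunov_nonincreasing : nonincreasing_seq (fun k => lyapunov k xb pb).
Proof.
apply/nonincreasing_seqP => k; apply: le_trans (lyapunov_decrease k).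
by rewrite -addrA lerDl addr_ge0// mulr_ge0 ?sqr_ge0 ?(ltW coefX_gt0) ?(ltW coefY_gt0).
Qed.

Lemma bregman_sum_le_lyapunov n N : (n <= N)%N ->
  bregman_sum sigma tau x p N xb pb <= (1 - contraction_ratio)^-1 * lyapunov n xb pb.
Proof.
move=> nN; have c0 : 0 < 1 - contraction_ratio by rewrite subr_gt0 contraction_ratio_lt1.
rewrite -ler_pdivrMl ?invr_gt0// invrK; apply: le_trans (lyapunov_ge N xb pb) _.
exact: lyapunov_nonincreasing nN.
Qed.

(** A nonincreasing sequence bounded below converges, so its differences vanish, and
    with them the squared increments that [lyapunov_decrease] bounds by them. *)
Lemma lyapunov_diff_cvg0 :
  lyapunov k xb pb - lyapunov k.+1 xb pb @[k --> \oo] --> (0 : R).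
Proof.
have cv : cvgn (fun k => lyapunov k xb pb).
  apply: nonincreasing_is_cvgn; first exact: lyapunov_nonincreasing.
  by exists 0 => _ [k _ <-]; exact: lyapunov_ge0.
rewrite -(subrr (limn (fun k => lyapunov k xb pb))); apply: cvgB => //.
by rewrite (cvg_shiftS (fun k => lyapunov k xb pb)).
Qed.

Let vanish (V : normedModType R) (c : R) (v : nat -> V) : 0 < c ->
  (forall k, c * `|v k| ^+ 2 <= lyapunov k xb pb - lyapunov k.+1 xb pb) ->
  v @ \oo --> (0 : V).
Proof.
move=> c0 vle; apply/cvgrPdist_lt => e e0.
have ce : 0 < c * e ^+ 2 by rewrite mulr_gt0 ?exprn_gt0.
have : \forall k \near \oo, lyapunov k xb pb - lyapunov k.+1 xb pb < c * e ^+ 2.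
  exact: (cvgr_lt _ lyapunov_diff_cvg0).
apply: filterS => k /(le_lt_trans (vle k)); rewrite ltr_pM2l// sub0r normrN.
by rewrite ltr_pXn2r ?nnegrE// ltW.
Qed.

Lemma inertia_cvg0 : inertia @ \oo --> (0 : X).
Proof.
apply: (@vanish X _ inertia coefX_gt0) => k; have := lyapunov_decrease k.
by have := mulr_ge0 (ltW coefY_gt0) (sqr_ge0 `|p k.+1 - p k|); lra.
Qed.

Lemma dual_increment_cvg0 : p k.+1 - p k @[k --> \oo] --> (0 : dual Y).
Proof.
apply: (@vanish (dual Y) _ (fun k => p k.+1 - p k) coefY_gt0) => k; have := lyapunov_decrease k.
by have := mulr_ge0 (ltW coefX_gt0) (sqr_ge0 `|inertia k|); lra.
Qed.

Lemma iterates_bounded : exists M, forall k, `|x k| <= M /\ `|p k| <= M.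
Proof.
pose K := (1 - contraction_ratio)^-1 * lyapunov 0 xb pb.
have sq_le (V : normedModType R) (z : nat -> V) (z0 : V) (c : R) : 0 < c ->
    (forall k, c * `|z0 - z k| ^+ 2 <= bregman_sum sigma tau x p k xb pb) ->
    forall k, `|z k| <= `|z0| + (1 + K / c).
  move=> c0 zle k; have h : `|z0 - z k| ^+ 2 <= K / c.
    by rewrite ler_pdivlMr// mulrC (le_trans (zle k))// bregman_sum_le_lyapunov.
  have := ler_normB z0 (z0 - z k); rewrite opprB addrCA subrr addr0.
  have := sqr_ge0 (`|z0 - z k| - 1); nra.
have cX : 0 < CX / 2 / tau by rewrite !divr_gt0.
have cY : 0 < CY / 2 / sigma by rewrite !divr_gt0.
have hx : forall k, `|x k| <= `|xb| + (1 + K / (CX / 2 / tau)).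
  by apply: sq_le => // k; have := bregman_sum_geX k xb pb; lra.
have hp : forall k, `|p k| <= `|pb| + (1 + K / (CY / 2 / sigma)).
  by apply: sq_le => // k; have := bregman_sum_geY k xb pb; lra.
exists (Num.max (`|xb| + (1 + K / (CX / 2 / tau))) (`|pb| + (1 + K / (CY / 2 / sigma)))) => k.
by rewrite !le_max hx hp orbT.
Qed.

End Solution.

(** * Ergodic estimates *)

Section Ergodic.
Hypotheses (fNy : forall u, f u != -oo%E) (f_convex : convex_efun f).
Hypotheses (gsNy : forall y, gs y != -oo%E) (gs_convex : convex_efun gs).

Let xN N := average x N.
Let pN N := average p N.

Let fx k : f (x k.+1) \is a fin_num.
Proof. by have /subdiffP[] := x_sub k. Qed.

Let gsp k : gs (p k.+1) \is a fin_num.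
Proof. by have /subdiffP[] := p_sub k. Qed.

Let fxN N : (0 < N)%N -> f (xN N) \is a fin_num.
Proof. by move=> N0; have [] := average_jensen fNy f_convex fx N0. Qed.

Let gspN N : (0 < N)%N -> gs (pN N) \is a fin_num.
Proof. by move=> N0; have [] := average_jensen gsNy gs_convex gsp N0. Qed.

(** The Lagrangian gap is convex in the iterates for a fixed reference point, so the
    gap at the averages is at most the average of the telescoped gaps. *)
Lemma ergodic_gap N u y : (0 < N)%N -> f u \is a fin_num -> gs y \is a fin_num ->
  (fine (f (xN N)) + y (T (xN N)) - fine (gs y)) -
  (fine (f u) + pN N (T u) - fine (gs (pN N))) <=
  N%:R^-1 * bregman_sum sigma tau x p 0 u y.
Proof.
move=> N0 fu gy; have N0' : 0 < N%:R :> R by rewrite ltr0n.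
have [_ jf] := average_jensen fNy f_convex fx N0.
have [_ jg] := average_jensen gsNy gs_convex gsp N0.
rewrite ler_pdivlMl//; apply: le_trans (sum_lagrangian_gap N fu gy).
have yE : N%:R * y (T (xN N)) = \sum_(1 <= k < N.+1) y (T (x k)).
  rewrite -(adjointE cT) average_linear mulVKf ?gt_eqF//.
have pE : N%:R * pN N (T u) = \sum_(1 <= k < N.+1) p k (T u).
  by rewrite -to_bidualE average_linear mulVKf ?gt_eqF.
rewrite /lagrangian_gap !sumrB !big_split /= !sumr_const_nat subSS subn0.
rewrite -(mulr_natl (fine (gs y))) -(mulr_natl (fine (f u))) -yE -pE.
move: jf jg; rewrite -/(xN N) -/(pN N); lra.
Qed.

(** [ergodic_gap] bounds each difference of an element of the first set and one of
    the second; infinite values of f and gs make that difference -oo. *)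
Lemma ergodic_restricted_gap (B1 : set X) (B2 : set (dual Y)) N : (0 < N)%N ->
  (ereal_sup [set (p' (T (xN N)))%:E - gs p' + f (xN N) | p' in B2] -
   ereal_inf [set (pN N (T x'))%:E - gs (pN N) + f x' | x' in B1] <=
   (N%:R^-1)%:E *
   ereal_sup [set (bregman_sum sigma tau x p 0 w.1 w.2)%:E | w in B1 `*` B2])%E.
Proof.
move=> N0; set S := ereal_sup [set (bregman_sum _ _ _ _ _ _ _)%:E | _ in _].
have Ninv : 0 < N%:R^-1 :> R by rewrite invr_gt0 ltr0n.
have [[x1 Bx1]|B10] := pselect (exists x1, B1 x1); last first.
  rewrite (_ : [set _ | x' in B1] = set0); last first.
    by apply/seteqP; split=> [t [x1 Bx1 _]|//]; case: B10; exists x1.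
  by rewrite ereal_inf0 /= addeNy leNye.
have [[y1 By1]|B20] := pselect (exists y1, B2 y1); last first.
  rewrite (_ : [set _ | p' in B2] = set0); last first.
    by apply/seteqP; split=> [t [y1 By1 _]|//]; case: B20; exists y1.
  by rewrite ereal_sup0 addNye leNye.
have SB u y : B1 u -> B2 y -> ((bregman_sum sigma tau x p 0 u y)%:E <= S)%E.
  by move=> Bu By; apply: ereal_sup_ubound; exists (u, y).
case E : S => [s| |]; last 2 first.
- by rewrite gt0_muley ?lte_fin// leey.
- by have := SB _ _ Bx1 By1; rewrite E.
rewrite -EFinM; have fN := fxN N0; have gN := gspN N0.
apply: ereal_sup_inf_le => [_ _ [y By <-] [u Bu <-]|_ [y By <-]|_ [u Bu <-]].
- have [fu|] := boolP (f u \is a fin_num); last first.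
    rewrite fin_numE fNy /= negbK => /eqP ->.
    by rewrite -(fineK gN) -EFinB addey// addeNy leNye.
  have [gy|] := boolP (gs y \is a fin_num); last first.
    rewrite fin_numE gsNy /= negbK => /eqP ->.
    by rewrite addeNy !addNye leNye.
  rewrite -(fineK gN) -(fineK fN) -(fineK fu) -(fineK gy) -?(EFinB, EFinD) -?(EFinB, EFinD) lee_fin /=.
  have := ergodic_gap N0 fu gy.
  have : N%:R^-1 * bregman_sum sigma tau x p 0 u y <= N%:R^-1 * s.
    by rewrite ler_pM2l// -lee_fin -E; exact: SB.
  rewrite /xN /pN; lra.
- by move: (gsNy y); rewrite -(fineK fN); case: (gs y).
- by move: (fNy u); rewrite -(fineK gN); case: (f u).
Qed.

Hypothesis f_minorant : forall (x0 : X) (M : R), (M%:E < f x0)%E ->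
  exists (phi : dual X) (c : R),
    (forall w, ((phi w + c)%:E <= f w)%E) /\ M < phi x0 + c.
Hypothesis gs_minorant : forall (p0 : dual Y) (M : R), (M%:E < gs p0)%E ->
  exists (phi : dual (dual Y)) (c : R),
    (forall q, ((phi q + c)%:E <= gs q)%E) /\ M < phi p0 + c.

(** Replacing f and gs by affine minorants turns the gap at the averages into a
    single continuous affine functional of the pair (x^N, p^N), whose bound
    Delta_0 (u, y) / N tends to 0. *)
Lemma ergodic_cluster_gap (xt : X) (pt : dual Y) (u : X) (y : dual Y) (a b : R) :
  weak_cluster_point (fun N => (average x N, average p N)) (xt, pt) ->
  f u \is a fin_num -> gs y \is a fin_num ->
  (a%:E < f xt)%E -> (b%:E < gs pt)%E ->
  a + y (T xt) - fine (gs y) - (fine (f u) + pt (T u) - b) <= 0.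
Proof.
move=> wcl fu gy /f_minorant[phi [c [phif ca]]] /gs_minorant[psi [d [psig db]]].
pose chi := pair_dual (phi + adjoint cT y) (psi - to_bidual (T u)).
pose K := fine (gs y) + fine (f u) - c - d.
suff : chi (xt, pt) <= K.
  rewrite pair_dualE /= !dualDE dualNE adjointE to_bidualE /K; lra.
apply: (weak_cluster_le wcl) => e e0; set D := bregman_sum sigma tau x p 0 u y.
have cv : N%:R^-1 * D @[N --> \oo] --> 0 * D.
  apply: cvgM; last exact: cvg_cst.
  rewrite -(cvg_shiftS (fun N => N%:R^-1 : R)); exact: cvg_harmonic.
have De : \forall N \near \oo, N%:R^-1 * D < e.
  by apply: (cvgr_lt _ cv); rewrite mul0r.
near=> N.
have N0 : (0 < N)%N by near: N; exact: nbhs_infty_gt.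
have DN : N%:R^-1 * D < e by near: N.
have := ergodic_gap N0 fu gy; have := phif (xN N); have := psig (pN N).
rewrite -(fineK (fxN N0)) -(fineK (gspN N0)) !lee_fin => h1 h2.
rewrite -/D pair_dualE /= !dualDE dualNE adjointE to_bidualE /K; move: DN h1 h2.
rewrite /xN /pN; move: (N%:R^-1 * D) => DN; lra.
Unshelve. all: by end_near. Qed.

(** The supremum over the minorants gives the saddle-point inequality at the cluster
    point. Reference points where f and gs are finite show that f xt and gs pt are
    finite; then y = pt and u = xt give the two subgradient inclusions. *)
Lemma ergodic_cluster_solution (xt : X) (pt : dual Y) :
  (exists u, f u \is a fin_num) -> (exists y, gs y \is a fin_num) ->
  weak_cluster_point (fun N => (average x N, average p N)) (xt, pt) ->
  subdiff f xt (adjoint cT (- pt)) /\ subdiff gs pt (to_bidual (T xt)).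
Proof.
move=> [u0 fu0] [y0 gy0] wcl; have gap := ergodic_cluster_gap wcl.
have le_f u y b : f u \is a fin_num -> gs y \is a fin_num -> (b%:E < gs pt)%E ->
    (f xt <= (fine (f u) + pt (T u) - b - y (T xt) + fine (gs y))%:E)%E.
  by move=> fu gy bg; apply: lee_of_reals => a af; have := gap u y a b fu gy af bg; lra.
have [b0 b0lt] : exists b0 : R, (b0%:E < gs pt)%E.
  have := gsNy pt; case: (gs pt) => [r| |] // _; last by exists 0; rewrite ltry.
  by exists (r - 1); rewrite lte_fin; lra.
have fxt : f xt \is a fin_num.
  by have := le_f _ _ _ fu0 gy0 b0lt; have := fNy xt; case: (f xt).
have le_g u y : f u \is a fin_num -> gs y \is a fin_num ->
    (gs pt <= (fine (f u) + pt (T u) - fine (f xt) - y (T xt) + fine (gs y))%:E)%E.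
  move=> fu gy; apply: lee_of_reals => b bg; have := le_f u y b fu gy bg.
  by rewrite -(fineK fxt) lee_fin /=; lra.
have gpt : gs pt \is a fin_num.
  by have := le_g _ _ fu0 gy0; have := gsNy pt; case: (gs pt).
have saddle u y : f u \is a fin_num -> gs y \is a fin_num ->
    fine (gs pt) <= fine (f u) + pt (T u) - fine (f xt) - y (T xt) + fine (gs y).
  by move=> fu gy; have := le_g u y fu gy; rewrite -{1}(fineK gpt) lee_fin.
split; apply/subdiffP; split=> //.
  move=> u; have [fu|] := boolP (f u \is a fin_num); last first.
    by rewrite fin_numE fNy /= negbK => /eqP ->; rewrite leey.
  have := saddle _ _ fu gpt.
  by rewrite -(fineK fu) -(fineK fxt) -EFinD lee_fin /= adjointE dualNE 2!linearB /=; lra.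
move=> y; have [gy|] := boolP (gs y \is a fin_num); last first.
  by rewrite fin_numE gsNy /= negbK => /eqP ->; rewrite leey.
have := saddle _ _ fxt gy.
by rewrite -(fineK gy) -(fineK gpt) -EFinD lee_fin /= to_bidualE dualDE dualNE; lra.
Qed.

End Ergodic.

(** * Strong convergence from a cluster point *)

Section StrongConvergence.
Hypotheses (smoothX : smooth_space X) (smoothY : smooth_space (dual Y)).
Hypotheses (f_proper : proper_fun f) (f_lsc : lower_semicontinuous f).
Hypotheses (gs_proper : proper_fun gs) (gs_lsc : lower_semicontinuous gs).
Variables (xb : X) (pb : dual Y).
Hypothesis xb_sub : subdiff f xb (adjoint cT (- pb)).
Hypothesis pb_sub : subdiff gs pb (to_bidual (T xb)).

Section ClusterPoint.
Variables (U : set_system nat).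
Context {UU : ProperFilter U}.
Hypothesis U_infty : U --> \oo.
Variables (xs : X) (ps : dual Y).
Hypothesis x_cvg : x k @[k --> U] --> xs.
Hypothesis p_cvg : p k @[k --> U] --> ps.

Let inertia_cvg : inertia k @[k --> U] --> (0 : X).
Proof. exact: cvg_trans (cvg_app _ U_infty) (inertia_cvg0 xb_sub pb_sub). Qed.

Let xS_cvg : x k.+1 @[k --> U] --> xs.
Proof.
have -> : (fun k => x k.+1) = (fun k => x k + inertia k.+1).
  by apply/funext => k; rewrite inertiaS addrC subrK.
rewrite -[xs]addr0; apply: cvgD => //.
apply: cvg_trans (cvg_app _ U_infty) _.
by rewrite (cvg_shiftS inertia); exact: inertia_cvg0 xb_sub pb_sub.
Qed.

Let pS_cvg : p k.+1 @[k --> U] --> ps.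
Proof.
have -> : (fun k => p k.+1) = (fun k => p k + (p k.+1 - p k)).
  by apply/funext => k; rewrite addrC subrK.
rewrite -[ps]addr0; apply: cvgD => //.
exact: cvg_trans (cvg_app _ U_infty) (dual_increment_cvg0 xb_sub pb_sub).
Qed.

Let apply_cvg (V : normedModType R) (q : nat -> dual V) (q0 : dual V) (v : nat -> V) (v0 : V) :
  q k @[k --> U] --> q0 -> v k @[k --> U] --> v0 -> q k (v k) @[k --> U] --> q0 v0.
Proof.
move=> qc vc; apply: (dual_cvg_apply (M := `|q0| + 1)) => // [|w].
  by apply: (cvgr_norm_le _ qc); rewrite ltrDl.
have cw := @dual_continuous _ _ (to_bidual w) q0.
exact: (cvg_comp _ _ qc cw).
Qed.

Let J_cvg (V : normedModType R) (sV : smooth_space V) (z : nat -> V) (z0 : V)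
    (v : nat -> V) (v0 : V) :
  z k @[k --> U] --> z0 -> v k @[k --> U] --> v0 ->
  duality_map (z k) (v k) @[k --> U] --> duality_map z0 v0.
Proof.
move=> zc vc; apply: (dual_cvg_apply (M := `|z0| + 1)) => // [|w].
  near=> k; rewrite duality_map_norm; near: k.
  by apply: (cvgr_norm_le _ zc); rewrite ltrDl.
exact: duality_map_demicontinuous.
Unshelve. all: by end_near. Qed.

Let T_cvg (v : nat -> X) (v0 : X) :
  v k @[k --> U] --> v0 -> T (v k) @[k --> U] --> T v0.
Proof. by move=> vc; apply: (cvg_comp _ _ vc); exact: cT. Qed.

(** Consecutive iterates have the same limit, so the differences of duality maps in
    the subgradients vanish weakly by demicontinuity, and what is left in the limit
    are the optimality conditions. *)
Lemma cluster_solution : subdiff f xs (adjoint cT (- ps)) /\ subdiff gs ps (to_bidual (T xs)).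
Proof.
split.
  apply: (subdiff_closed f_proper f_lsc _ xS_cvg); first by apply: nearW => k; exact: x_sub.
  move=> w; have vc : w - x k.+1 @[k --> U] --> w - xs.
    by apply: cvgB => //; exact: cvg_cst.
  have -> : adjoint cT (- ps) (w - xs) =
     tau^-1 * (duality_map xs (w - xs) - tau * ps (T (w - xs)) - duality_map xs (w - xs)).
    by rewrite adjointE dualNE; field; rewrite gt_eqF.
  under eq_fun do rewrite !(dualZE, dualDE, dualNE) adjointE mulrN.
  apply: cvgM; first exact: cvg_cst.
  apply: cvgB; last exact: J_cvg.
  apply: cvgB; first exact: J_cvg.
  by apply: cvgM; [exact: cvg_cst|apply: apply_cvg => //; exact: T_cvg].
apply: (subdiff_closed gs_proper gs_lsc _ pS_cvg); first by apply: nearW => k; exact: p_sub.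
move=> w; have vc : w - p k.+1 @[k --> U] --> w - ps.
  by apply: cvgB => //; exact: cvg_cst.
have xhatc : T (xhat k) @[k --> U] --> T xs.
  apply: T_cvg; have -> : (fun k => xhat k) = (fun k => x k + inertia k).
    by apply/funext => k; rewrite /inertia addrC subrK.
  by rewrite -[xs]addr0; apply: cvgD.
have -> : to_bidual (T xs) (w - ps) =
   sigma^-1 * (duality_map ps (w - ps) + sigma * (w - ps) (T xs) - duality_map ps (w - ps)).
  by rewrite to_bidualE; field; rewrite gt_eqF.
under eq_fun do rewrite !(dualZE, dualDE, dualNE) to_bidualE.
apply: cvgM; first exact: cvg_cst.
apply: cvgB; last exact: J_cvg.
apply: cvgD; first exact: J_cvg.
by apply: cvgM; [exact: cvg_cst|exact: apply_cvg].
Qed.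

Let bregman_cvg0 (V : normedModType R) (sV : smooth_space V) (z : nat -> V) (z0 : V) :
  z k @[k --> U] --> z0 -> bregman z0 (z k) @[k --> U] --> (0 : R).
Proof.
move=> zc.
have -> : 0 = energy z0 - energy z0 - duality_map z0 (z0 - z0).
  by rewrite !subrr linear0 subr0.
apply: cvgB; last by apply: J_cvg => //; apply: cvgB => //; exact: cvg_cst.
by apply: cvgB; [exact: cvg_cst|exact: energy_cvg].
Qed.

Lemma lyapunov_cluster_cvg0 : lyapunov k xs ps @[k --> U] --> (0 : R).
Proof.
have -> : 0 = 0 / sigma + 0 / tau - (ps - ps) (T 0) + CX / 2 * (`|0 : X| * `|0 : X|) / tau.
  by rewrite normr0 !mul0r !mulr0 mul0r linear0 (linear0 (ps - ps)) subr0 !addr0.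
rewrite /lyapunov /bregman_sum; under eq_fun do rewrite expr2.
have nc := cvg_norm inertia_cvg.
apply: cvgD.
  apply: cvgB.
    by apply: cvgD; apply: cvgM; [exact: bregman_cvg0|exact: cvg_cst|exact: bregman_cvg0|exact: cvg_cst].
  apply: apply_cvg; last exact: T_cvg.
  by apply: cvgB => //; exact: cvg_cst.
apply: cvgM; last exact: cvg_cst.
apply: cvgM; first exact: cvg_cst.
by apply: cvgM; exact: nc.
Qed.

(** The Lyapunov function with the cluster point itself as reference is monotone and
    tends to 0 along the filter, hence along the whole sequence. *)
Lemma cluster_strong_cvg : x k @[k --> \oo] --> xs /\ p k @[k --> \oo] --> ps.
Proof.
have [xs_sub ps_sub] := cluster_solution.
have c0 : 0 < (1 - contraction_ratio)^-1.
  by rewrite invr_gt0 subr_gt0 contraction_ratio_lt1.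
have D0 (e : R) : 0 < e -> \forall k \near \oo, bregman_sum sigma tau x p k xs ps < e.
  move=> e0; have e1 : 0 < e / (1 - contraction_ratio)^-1 by rewrite divr_gt0.
  have : \forall k \near U, lyapunov k xs ps < e / (1 - contraction_ratio)^-1.
    exact: (cvgr_lt _ lyapunov_cluster_cvg0).
  move=> /filter_ex[n ln]; near=> k.
  apply: le_lt_trans (bregman_sum_le_lyapunov xs_sub ps_sub (_ : (n <= k)%N)) _.
    by near: k; exact: nbhs_infty_ge.
  by rewrite mulrC -ltr_pdivlMr.
have sq_cvg (V : normedModType R) (z : nat -> V) (z0 : V) (c : R) : 0 < c ->
    (forall k, c * `|z0 - z k| ^+ 2 <= bregman_sum sigma tau x p k xs ps) ->
    z k @[k --> \oo] --> z0.
  move=> cpos zle; apply/cvgrPdist_lt => e e0.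
  have ce : 0 < c * e ^+ 2 by rewrite mulr_gt0 ?exprn_gt0.
  apply: filterS (D0 _ ce) => k /(le_lt_trans (zle k)); rewrite ltr_pM2l//.
  by rewrite ltr_pXn2r ?nnegrE// ltW.
split.
  apply: (sq_cvg _ _ _ (CX / 2 / tau)) => [|k]; first by rewrite !divr_gt0.
  by have := bregman_sum_geX k xs ps; lra.
apply: (sq_cvg _ _ _ (CY / 2 / sigma)) => [|k]; first by rewrite !divr_gt0.
by have := bregman_sum_geY k xs ps; lra.
Unshelve. all: by end_near. Qed.

End ClusterPoint.

End StrongConvergence.

End Lyapunov.

(** * Boundedness, ergodic rate and convergence *)

Theorem theorem3 (R : realType) (X Y : completeNormedModType R)
  (reflX : reflexive_space X) (smoothX : smooth_space X) (cvxX : two_convex X)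
  (reflY : reflexive_space (dual Y)) (smoothY : smooth_space (dual Y))
  (cvxY : two_convex (dual Y))
  (T : {linear X -> Y}) (cT : continuous T)
  (f : X -> \bar R) (g : Y -> \bar R) (fG : Gamma f) (gG : Gamma g)
  (f_ge0 : forall x, (0 <= f x)%E) (g_ge0 : forall y, (0 <= g y)%E)
  (solvable : exists x q, saddle_solution cT f g x q)
  (CX CY : R) (CX_gt0 : 0 < CX) (CY_gt0 : 0 < CY)
  (bregX : forall x u : X, CX / 2 * `|x - u| ^+ 2 <= bregman x u)
  (bregY : forall y p : dual Y, CY / 2 * `|y - p| ^+ 2 <= bregman y p)
  (sigma tau : R) (sigma_gt0 : 0 < sigma) (tau_gt0 : 0 < tau)
  (step : Num.sqrt (sigma * tau) * opnorm T < Num.min CX CY)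
  (x xhat : nat -> X) (p : nat -> dual Y)
  (xhat0 : xhat 0%N = x 0%N)
  (p_iter : forall k, p k.+1 =
    resolvent sigma (fenchel_conj g)
      (duality_map (p k) + sigma *: to_bidual (T (xhat k))))
  (x_iter : forall k, x k.+1 =
    resolvent tau f (duality_map (x k) - tau *: adjoint cT (p k.+1)))
  (xhat_iter : forall k, xhat k.+1 = x k.+1 + (x k.+1 - x k)) :
  [/\ [bounded (x k, p k) | k in [set: nat]] /\
      (forall (xbar : X) (pbar : dual Y), saddle_solution cT f g xbar (- pbar) ->
        exists2 C : R,
          C <= (1 - opnorm T ^+ 2 * sigma * tau / (CX * CY))^-1 &
          forall N, bregman_sum sigma tau x p N xbar pbar <=
                    C * bregman_sum sigma tau x p 0 xbar pbar),
      (forall (B1 : set X) (B2 : set (dual Y)), bounded_set (B1 `*` B2) ->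
        forall N, (0 < N)%N ->
          (restricted_gap T f g B1 B2 (average x N) (average p N) <=
           (N%:R^-1)%:E *
           ereal_sup [set (bregman_sum sigma tau x p 0 w.1 w.2)%:E
                     | w in B1 `*` B2])%E) /\
      (forall (xt : X) (pt : dual Y),
        weak_cluster_point (fun N => (average x N, average p N)) (xt, pt) ->
        saddle_solution cT f g xt (- pt)) &
      finite_dimensional X -> finite_dimensional Y ->
      exists (xbar : X) (pbar : dual Y), saddle_solution cT f g xbar (- pbar) /\
        (fun k => (x k, p k)) @ \oo --> (xbar, pbar)].

Proof.
have [[gNy [y1 gy1]] _ _] := gG.
have [u0 [q0 [u0_sub q0_sub]]] := solvable.
have gsG : Gamma (fenchel_conj g).
  apply: Gamma_fenchel_conj; first by case: gG.
  by exists (- q0); have /subdiffP[+ _] := q0_sub; rewrite fin_numE => /andP[].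
have dy1 : g y1 \is a fin_num by rewrite fin_numE gNy gy1.
have completeX := complete_sequentially (X := X).
have x_sub k : subdiff f (x k.+1)
    (tau^-1 *: (duality_map (x k) + tau *: (- adjoint cT (p k.+1)) - duality_map (x k.+1))).
  have f_lb z : (((0 : dual X) z + 0)%:E <= f z)%E by rewrite addr0; exact: f_ge0.
  have := resolvent_subdiff completeX CX_gt0 bregX smoothX fG f_lb tau_gt0
    (duality_map (x k) - tau *: adjoint cT (p k.+1)).
  by rewrite -x_iter scalerN.
have p_sub k : subdiff (fenchel_conj g) (p k.+1)
    (sigma^-1 *: (duality_map (p k) + sigma *: to_bidual (T (xhat k)) - duality_map (p k.+1))).
  have := resolvent_subdiff (@dual_sequentially_complete _ Y) CY_gt0 bregY smoothY gsG
    (fun q => fenchel_conj_minorant q dy1) sigma_gt0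
    (duality_map (p k) + sigma *: to_bidual (T (xhat k))).
  by rewrite -p_iter.
have solE xb pb : saddle_solution cT f g xb (- pb) <->
    subdiff f xb (adjoint cT (- pb)) /\ subdiff (fenchel_conj g) pb (to_bidual (T xb)).
  by rewrite /saddle_solution opprK.
have [u0f q0f] : f u0 \is a fin_num /\ fenchel_conj g (- q0) \is a fin_num.
  by have /subdiffP[] := u0_sub; have /subdiffP[] := q0_sub.
have sol0 : saddle_solution cT f g u0 (- - q0) by rewrite opprK.
have /solE[u0s q0s] := sol0.
have [M xpM] := iterates_bounded CX_gt0 CY_gt0 bregX bregY sigma_gt0 tau_gt0 step
  xhat_iter p_sub x_sub u0s q0s.
have [[fNy fx] fconv flsc] := fG; have [[gsNy gsx] gsconv gslsc] := gsG.
split.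
- split.
    exists M; split=> [|r Mr k _ /=]; first exact: num_real.
    have [xM pM] := xpM k; apply: le_trans (ltW Mr).
    by rewrite prod_normE /= ge_max xM.
  move=> xb pb /solE[xbs pbs]; exists (1 - opnorm T ^+ 2 * sigma * tau / (CX * CY))^-1 => // N.
  rewrite -(lyapunov0 T CX sigma tau p xhat0).
  exact: (bregman_sum_le_lyapunov CX_gt0 CY_gt0 bregX bregY sigma_gt0 tau_gt0 step
    xhat_iter p_sub x_sub xbs pbs).
- split=> [B1 B2 _ N N0|xt pt wcl].
    exact: (ergodic_restricted_gap CX_gt0 CY_gt0 bregX bregY sigma_gt0 tau_gt0 step
      xhat0 xhat_iter p_sub x_sub fNy fconv gsNy gsconv).
  apply/solE.
  apply: (ergodic_cluster_solution CX_gt0 CY_gt0 bregX bregY sigma_gt0 tau_gt0 step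
      xhat0 xhat_iter p_sub x_sub fNy fconv gsNy gsconv _ _ _ _ wcl).
  + move=> x1 a; exact: (affine_minorant_gt completeX CX_gt0 bregX smoothX fG f_ge0).
  + move=> p1 a /(fenchel_conj_gt gNy)[y gy ay].
    exists (to_bidual y), (- fine (g y)); split=> // w; exact: fenchel_conj_minorant.
  + by exists u0.
  + by exists (- q0).
- move=> /finite_dimensional_frame[sX frameX] /finite_dimensional_frame[sY /dual_frame frameY].
  have [U [UU U_infty]] := ultraFilterLemma (F := \oo) _.
  have [xs x_cvg] := frame_ultra_cvg UU frameX (fun k => (xpM k).1).
  have [ps p_cvg] := frame_ultra_cvg UU frameY (fun k => (xpM k).2).
  have [xs_sub ps_sub] := cluster_solution CX_gt0 CY_gt0 bregX bregY sigma_gt0 tau_gt0 step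
    xhat_iter p_sub x_sub smoothX smoothY (conj fNy fx) flsc (conj gsNy gsx) gslsc
    u0s q0s U_infty x_cvg p_cvg.
  have [xc pc] := cluster_strong_cvg CX_gt0 CY_gt0 bregX bregY sigma_gt0 tau_gt0 step
    xhat_iter p_sub x_sub smoothX smoothY (conj fNy fx) flsc (conj gsNy gsx) gslsc
    u0s q0s U_infty x_cvg p_cvg.
  exists xs, ps; split; first exact/solE.
  exact: (cvg_pair xc pc).
Qed.
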